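(* Let $0<q<1$, let $N\ge1$ be an integer and $k\in\mathbb{N}$. The following identity holds: $$\sum_\lambda F_{N,k}(\lambda)\,q^{|\lambda|}\,s_\lambda(1^N)\,s_\lambda(1^N)=\frac{q^k(N+1)_k}{(1-q)^{N^2+k}(k+1)}\;{}_3F_2\left(\begin{matrix}-k,-k,1-N\\ 1,-N-k\end{matrix};\frac1q\right),$$ where the sum is over all integer partitions $\lambda$ (the terms with $\lambda$ having more than $N$ parts being $0$, since then $s_\lambda(1^N)=0$).
   Context: Conventions: $\mathbb{N}=\{0,1,2,\dots\}$; an empty product is $1$. For an integer partition $\lambda$, $|\lambda|=\sum_i\lambda_i$; $s_\lambda(x_1,\dots,x_N)$ is the Schur polynomial in $N$ variables, and $s_\lambda(1^N)=s_\lambda(1,\dots,1)$ ($N$ ones). For $\lambda$ with at most $N$ parts (padded by zeros to length $N$), $$F_{N,k}(\lambda)=\frac1N\sum_{i=1}^N(\lambda_i+N-i)(\lambda_i+N-i-1)\cdots(\lambda_i+N-i-k+1).$$ Hypergeometric notation: $(a)_i=a(a+1)\cdots(a+i-1)$ and ${}_3F_2\left(\begin{matrix}a,b,c\\ d,e\end{matrix};z\right)=\sum_{i\ge0}\frac{(a)_i(b)_i(c)_i}{(d)_i(e)_i}\frac{z^i}{i!}$, where the series terminates at the first vanishing numerator factor if one of $a,b,c$ is a nonpositive integer (so the ${}_3F_2$ in the statement is the finite sum over $0\le i\le\min(k,N-1)$, in which no denominator vanishes). *)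

(* Defs.v *)
From HB Require Import structures.
From mathcomp Require Import all_boot all_order all_algebra.
From mathcomp Require Import all_classical all_reals all_analysis.

Set Implicit Arguments.
Unset Strict Implicit.
Unset Printing Implicit Defensive.

Import Order.TTheory GRing.Theory Num.Theory numFieldNormedType.Exports.
Local Open Scope ring_scope.

(* Partitions are weakly decreasing sequences of positive parts, without
   trailing zeros, so that each partition is represented exactly once. *)
Definition is_partition (la : seq nat) : bool :=
  sorted geq la && (0%N \notin la).

Definition ydcell (la : seq nat) : finType :=
  {i : 'I_(size la) & 'I_(nth 0%N la i)}.

Definition yrow (la : seq nat) (c : ydcell la) : nat := tag c.
Definition ycol (la : seq nat) (c : ydcell la) : nat := tagged c.

Definition semistandard (la : seq nat) (N : nat)
    (T : {ffun ydcell la -> 'I_N}) : bool :=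
  [forall c, forall d,
     ((yrow c == yrow d) && (ycol c <= ycol d)%N ==> (T c <= T d)%N) &&
     ((ycol c == ycol d) && (yrow c < yrow d)%N ==> (T c < T d)%N)].

(* The Schur polynomial s_la(x_0, ..., x_(N-1)), evaluated at a point x of a
   commutative ring: the sum of the monomials x^T over the semistandard
   tableaux T of shape la with entries in {0, ..., N-1}. *)
Definition schur (A : comNzRingType) (N : nat) (la : seq nat)
    (x : 'I_N -> A) : A :=
  \sum_(T : {ffun ydcell la -> 'I_N} | semistandard T) \prod_c x (T c).

(* With i counted from 0, the i-th shifted part is la_i + (N - i - 1), and
   nth pads la with zeros.  m ^_ k is m (m - 1) ... (m - k + 1), which is 0
   for k > m, like the same product computed in the integers.
   Only meaningful when la has at most N parts. *)
Definition Fmean (R : realType) (N k : nat) (la : seq nat) : R :=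
  N%:R^-1 * \sum_(i < N) ((nth 0%N la i + (N - i.+1)) ^_ k)%:R.

Definition pochhammer (R : realType) (a : R) (i : nat) : R :=
  \prod_(j < i) (a + j%:R).

(* If a, b or c is a nonpositive integer, the numerator vanishes from some
   rank on, and 0 / x = 0 for all x, including x = 0: the series is then the
   finite sum stopped at the first vanishing numerator. *)
Definition hyp3F2 (R : realType) (a b c d e z : R) : R :=
  limn (series (fun i : nat =>
    pochhammer a i * pochhammer b i * pochhammer c i
      / (pochhammer d i * pochhammer e i) * (z ^+ i / i`!%:R))).

(* Main.v *)
(* The number s_la(1^N) of semistandard tableaux is computed by removing the
   entries equal to N, which leaves a tableau whose shape interlaces with la.
   Row operations show that the determinant det('C(l_i, N-1-j)) in the shifted
   parts l_i = la_i + N-1-i obeys the same branching rule, so the two agree.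

   The left-hand side thus becomes a sum over strictly decreasing l, and, after
   symmetrization, over all l in N^N, of
   (sum_m f(l_m)) prod_i q^(l_i) det('C(l_i, N-1-j))^2, where f(x) = x^_k.
   Replacing the binomials by the Meixner polynomials P_n, orthogonal for the
   weight q^x, and using Andreief's identity, one gets the trace
   sum_(n < N) (sum_x q^x f(x) P_n(x)^2) / (sum_x q^x P_n(x)^2).
   With S and S' the shifts of the two indices and y = 1 / (1 - q), summation by
   parts shows that A_k(n, m) = sum_x q^x 'C(x, k) P_n(x) P_m(x) satisfies
   (1 - q) (1 - q y^2 S S') A_k = q (1 + y S) (1 + y S') A_(k-1), whence
   A_k(n, m) = q^k y^(k+1) sum_p 'C(k, n-p) 'C(k, m-p) 'C(p+k, k) y^(n+m) q^p;
   the sum over n is then a hockey-stick sum. *)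

Require Import Defs.
From mathcomp Require Import all_boot all_order all_algebra.
From mathcomp Require Import all_classical all_reals all_analysis.
From mathcomp Require Import perm zify ring lra.
Import Order.TTheory GRing.Theory Num.Theory numFieldNormedType.Exports.
Local Open Scope classical_set_scope.
Local Open Scope ring_scope.

(** * Branching of semistandard fillings *)

(* A semistandard tableau of shape [la] with entries in [0, M), extended by the
   value [M] to an [a] by [b] rectangle containing its shape. *)
Definition filling (a b B M : nat) (la : nat -> nat)
    (T : {ffun 'I_a * 'I_b -> 'I_B}) : bool :=
  [forall i, forall j,
    [&& (T (i, j) <= M)%N, ((T (i, j) < M) == (j < la i))%N,
      [forall j' : 'I_b, (j <= j')%N ==> (T (i, j) <= T (i, j'))%N] &
      [forall i' : 'I_a, (i < i')%N ==> (T (i, j) < M)%N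
         ==> (T (i, j) < T (i', j))%N]]].

Lemma fillingP (a b B M : nat) (la : nat -> nat)
    (T : {ffun 'I_a * 'I_b -> 'I_B}) :
  reflect [/\ forall i j, (T (i, j) <= M)%N,
     forall i j, (T (i, j) < M)%N = (j < la i)%N,
     forall i (j j' : 'I_b), (j <= j')%N -> (T (i, j) <= T (i, j'))%N &
     forall (i i' : 'I_a) j, (i < i')%N -> (T (i, j) < M)%N ->
       (T (i, j) < T (i', j))%N]
    (filling a b B M la T).
Proof.
apply: (iffP 'forall_forallP) => [H|[H1 H2 H3 H4] i j].
  split=> [i j|i j|i j j'|i i' j].
  - by case/and4P: (H i j).
  - by case/and4P: (H i j) => _ /eqP.
  - by case/and4P: (H i j) => _ _ /forallP /(_ j') /implyP.
  - by case/and4P: (H i j) => _ _ _ /forallP /(_ i') /implyP h /h /implyP.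
rewrite H1 H2 eqxx /=; apply/andP; split.
  by apply/forallP => j'; apply/implyP; apply: H3.
by apply/forallP => i'; apply/implyP => lt_ii; apply/implyP; rewrite -H2; apply: H4.
Qed.

(* Column strictness, and the fact that the shape is a partition, push the
   entries of row [i] up to at least [i]. *)
Lemma filling_row_ge (a b B M : nat) (la : nat -> nat)
    (T : {ffun 'I_a * 'I_b -> 'I_B}) (i : 'I_a) (j : 'I_b) :
  {homo la : m n / (m <= n)%N >-> (n <= m)%N} -> filling a b B M la T ->
  (minn i M <= T (i, j))%N.
Proof.
move=> laD /fillingP[T1 T2 T3 T4]; case: i => i i_lt /=.
elim: i i_lt => [|i IHi] i_lt; first by rewrite min0n.
have {IHi} := IHi (ltnW i_lt); set x := Ordinal _; set x' := Ordinal _ => IH.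
have := T2 x j; have := T2 x' j; have := T4 x x' j (ltnSn _); have := T1 x j.
have := laD _ _ (leqnSn i); rewrite /x /x' /=; set t := T _; set t' := T _.
move=> ? ? h; have [/h|] := ltnP t M; move: IH; rewrite -/t; lia.
Qed.

Definition interlaced (b n : nat) (la : nat -> nat) (mu : {ffun 'I_n -> 'I_b}) :
    bool :=
  [forall i : 'I_n, (la i.+1 <= mu i)%N && (mu i <= la i)%N].

Definition padded (b n : nat) (mu : {ffun 'I_n -> 'I_b}) (i : nat) : nat :=
  if insub i is Some i' then mu i' else 0%N.

Lemma paddedE (b n : nat) (mu : {ffun 'I_n -> 'I_b}) (i : 'I_n) :
  padded b n mu i = mu i.
Proof. by rewrite /padded valK. Qed.

Lemma padded_ge (b n : nat) (mu : {ffun 'I_n -> 'I_b}) (i : nat) :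
  (n <= i)%N -> padded b n mu i = 0%N.
Proof. by move=> le_n; rewrite /padded insubF // ltnNge le_n. Qed.

Lemma padded_lt (b n : nat) (mu : {ffun 'I_n -> 'I_b}) (i : nat)
  (lt_i : (i < n)%N) : padded b n mu i = mu (Ordinal lt_i).
Proof. by rewrite -paddedE. Qed.

Lemma interlacedP (b n : nat) (la : nat -> nat) (mu : {ffun 'I_n -> 'I_b}) :
    {homo la : m p / (m <= p)%N >-> (p <= m)%N} ->
    (forall i, (n < i)%N -> la i = 0%N) -> interlaced b n la mu ->
  forall i, (la i.+1 <= padded b n mu i)%N && (padded b n mu i <= la i)%N.
Proof.
move=> laD la0 /forallP mu_la i; have [i_lt|i_ge] := ltnP i n.
  by rewrite padded_lt; apply: mu_la.
by rewrite padded_ge // la0.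
Qed.

(** For a downward closed [P], the length of the initial segment of ['I_b] on which [P] holds. The
    value [b] always qualifies, so the minimum exists; hence the codomain ['I_b.+1]. *)
Definition cut (b : nat) (P : pred 'I_b) : 'I_b.+1 :=
  [arg min_(c < ord_max | [forall j : 'I_b, (c <= j)%N ==> ~~ P j]) c]%N.

Lemma ltn_cut (b : nat) (P : pred 'I_b) :
    (forall j j' : 'I_b, (j <= j')%N -> P j' -> P j) ->
  forall j : 'I_b, (j < cut b P)%N = P j.
Proof.
move=> Pdown j; rewrite /cut; case: arg_minnP => [|c /forallP cP cmin].
  by apply/forallP => j' /=; rewrite leqNgt ltn_ord.
apply/idP/idP => [|Pj]; last first.
  by rewrite ltnNge; apply/negP => le_cj; have := cP j; rewrite le_cj Pj.
apply: contraTT => nPj; rewrite -leqNgt.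
have := cmin (widen_ord (leqnSn b) j); apply.
by apply/forallP => j' /=; apply/implyP => /Pdown Pd; apply: contra nPj; apply: Pd.
Qed.

(** The largest letter [n] is removed by capping the filling at [n], the value that marks the
    outside one level down. The cells with entries below [n] form the shape [mu]; column strictness
    leaves at most one [n] in each column, which is interlacing. Given [la], the capped filling
    determines the original one. *)
Lemma filling_branch (a b n B : nat) (la : nat -> nat) :
    {homo la : m p / (m <= p)%N >-> (p <= m)%N} ->
    (forall i, (n < i)%N -> la i = 0%N) -> (la 0 <= b)%N ->
    (n < a)%N -> (n.+1 < B)%N ->
  (#|[set T | filling a b B n.+1 la T]|%SET =
   \sum_(mu : {ffun 'I_n -> 'I_b.+1} | interlaced b.+1 n la mu)
     #|[set T | filling a b B n (padded b.+1 n mu) T]|%SET)%N.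
Proof.
move=> laD la0 lab n_a; case: B => // B n_B.
have la_b i : (la i <= b)%N by apply: leq_trans lab; apply: laD.
pose mu_of (T : {ffun 'I_a * 'I_b -> 'I_B.+1}) : {ffun 'I_n -> 'I_b.+1} :=
  [ffun i => cut b [pred j | (T (widen_ord (ltnW n_a) i, j) < n)%N]].
have mu_ofP T : filling a b B.+1 n.+1 la T ->
    forall i j, (T (i, j) < n)%N = (j < padded b.+1 n (mu_of T) i)%N.
  move=> fT i j; have /fillingP[T1 T2 T3 T4] := fT.
  (* By [filling_row_ge], rows from [n] on hold no entry below [n], so nothing is lost by keeping
     only [n] parts of [mu]. *)
  have [i_lt|i_ge] := ltnP i n; last first.
    rewrite padded_ge // ltn0; apply/negbTE; rewrite -leqNgt.
    by apply: leq_trans (filling_row_ge _ _ _ _ _ _ i j laD fT); lia.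
  rewrite padded_lt ffunE ltn_cut /=; last first.
    by move=> j1 j2 le_j; apply: leq_ltn_trans; apply: T3.
  by congr (T (_, _) < n)%N; apply: val_inj.
have muP (T : {ffun 'I_a * 'I_b -> 'I_B.+1}) (mu : {ffun 'I_n -> 'I_b.+1}) :
    (forall i j, (T (i, j) < n)%N = (j < padded b.+1 n mu i)%N) ->
    mu_of T = mu.
  move=> Tmu; apply/ffunP => i; rewrite ffunE; apply/val_inj => /=.
  have eq_lt (j : 'I_b) :
      (j < cut b [pred j | (T (widen_ord (ltnW n_a) i, j) < n)%N])%N = (j < mu i)%N.
    rewrite ltn_cut /= => [|j1 j2 le_j].
      by rewrite Tmu /= paddedE.
    by rewrite !Tmu; apply: leq_ltn_trans.
  move: (cut _ _) eq_lt => c eq_lt.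
  have [] := (leq_ord c, leq_ord (mu i)).
  have [c_lt|c_gt|//] := ltngtP (c : nat) (mu i).
    move=> _ /(leq_trans c_lt) c_b; have := eq_lt (Ordinal c_b).
    by rewrite /= c_lt ltnn.
  move=> /(leq_trans c_gt) c_b _; have := eq_lt (Ordinal c_b).
  by rewrite /= c_gt ltnn.
rewrite -sum1_card (partition_big mu_of (interlaced b.+1 n la)) /=; last first.
  move=> T; rewrite inE => fT; have /fillingP[T1 T2 T3 T4] := fT.
  apply/forallP => i; rewrite -paddedE; set i' := widen_ord (ltnW n_a) i.
  rewrite -[i : nat]/(i' : nat); apply/andP; split; rewrite leqNgt.
    (* Otherwise column [mu i] has its cells in rows [i] and [i.+1] both inside [la]: the upper
       entry is [n], and the lower one would exceed [n] while staying below [n.+1]. *)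
    apply/negP => lt_i.
    have lt_b := leq_trans lt_i (la_b i.+1).
    have i1_a : (i.+1 < a)%N by exact: leq_ltn_trans (ltn_ord i) n_a.
    have /= := T2 (Ordinal i1_a) (Ordinal lt_b).
    have := mu_ofP T fT i' (Ordinal lt_b); rewrite /= ltnn lt_i.
    have := T4 i' (Ordinal i1_a) (Ordinal lt_b) (ltnSn _).
    have := T2 i' (Ordinal lt_b); rewrite /= (leq_trans lt_i (laD _ _ (leqnSn i))).
    by move=> -> /(_ isT); lia.
  apply/negP => lt_i.
  have lt_b : (la i' < b)%N.
    by apply: leq_trans lt_i _; rewrite paddedE leq_ord.
  pose j : 'I_b := Ordinal lt_b; have := T2 i' j; rewrite ltnn => /negbT.
  have := mu_ofP T fT i' j; rewrite lt_i => Tj_lt; rewrite -leqNgt.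
  by apply/negP; rewrite -ltnNge ltnW.
apply: eq_bigr => mu mu_la; rewrite sum1_card.
have mu_laP := interlacedP _ _ _ _ laD la0 mu_la.
pose f (T : {ffun 'I_a * 'I_b -> 'I_B.+1}) : {ffun 'I_a * 'I_b -> 'I_B.+1} :=
  [ffun p => inord (minn (T p) n)].
have fE T p : f T p = minn (T p) n :> nat.
  by rewrite ffunE inordK // (leq_ltn_trans (geq_minr _ _)) // ltnW // ltnW.
pose A := [set T | filling a b B.+1 n.+1 la T && (mu_of T == mu)]%SET.
transitivity #|A|; first by apply: eq_card => T; rewrite unfold_in !inE.
rewrite -(@card_in_imset _ _ f A) => [|T T' ]; last first.
  rewrite /A !inE => /andP[/fillingP[T1 T2 _ _] _] /andP[/fillingP[T1' T2' _ _] _].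
  move=> /ffunP eq_f; apply/ffunP => -[i j]; apply/val_inj => /=.
  have := fE T (i, j); rewrite eq_f fE.
  move: (T1 i j) (T2 i j) (T1' i j) (T2' i j).
  by move: (nat_of_ord (T _)) (nat_of_ord (T' _)) => t t'; lia.
apply: eq_card => T'; rewrite inE; apply/imsetP/idP.
  case=> T; rewrite /A !inE => /andP[fT /eqP muT] ->.
  have := mu_ofP T fT; rewrite muT => Tmu.
  move: fT => /fillingP[T1 T2 T3 T4].
  apply/fillingP; split => [i j|i j|i j j' le_j|i i' j lt_i]; rewrite !fE.
  - exact: geq_minr.
  - by rewrite -Tmu; lia.
  - move: (T3 i j j' le_j); lia.
  - move: (T4 i i' j lt_i); lia.
move=> fT'; have /fillingP[T1 T2 T3 T4] := fT'.
(* The inverse of capping: the cells of [la] outside [mu] keep the value [n], now a letter, and the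
   cells outside [la] are raised to [n.+1]. *)
pose T : {ffun 'I_a * 'I_b -> 'I_B.+1} :=
  [ffun p : 'I_a * 'I_b => if (p.2 < la p.1)%N then T' p else inord n.+1].
have TE (i : 'I_a) (j : 'I_b) :
    T (i, j) = (if (j < la i)%N then T' (i, j) : nat else n.+1) :> nat.
  by rewrite ffunE /=; case: ifP => // _; rewrite inordK.
have mu_le i : (padded b.+1 n mu i <= la i)%N by case/andP: (mu_laP i).
exists T; last first.
  apply/ffunP => -[i j]; apply: val_inj; rewrite /= fE TE.
  by move: (T2 i j) (T1 i j) (mu_le i); move: (nat_of_ord (T' _)) => t'; case: ifP; lia.
rewrite /A !inE; apply/andP; split; last first.
  apply/eqP; apply: muP => i j; rewrite TE -T2; have := mu_le i.
  by move: (T2 i j); move: (nat_of_ord (T' _)) => t'; case: ifP; lia.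
apply/fillingP; split => [i j|i j|i j j' le_j|i i' j lt_i]; rewrite !TE.
- by move: (T1 i j); move: (nat_of_ord (T' _)) => t'; case: ifP; lia.
- by move: (T1 i j); move: (nat_of_ord (T' _)) => t'; case: ifP; lia.
- move: (le_j) (T3 i j j' le_j) (T1 i j).
  move: (nat_of_ord (T' (i, j))) (nat_of_ord (T' (i, j'))) => t t'.
  by do 2 case: ifP; lia.
have /andP[h _] := mu_laP i; move: (lt_i) h (laD _ _ lt_i).
move: (T4 i i' j lt_i) (T1 i j) (T2 i j).
move: (nat_of_ord (T' (i, j))) (nat_of_ord (T' (i', j))) => t t'.
by do 2 case: ifP; lia.
Qed.

(** * Branching of the binomial determinant *)

Definition shifted (n : nat) (la : nat -> nat) (i : nat) : nat :=
  (la i + (n - i.+1))%N.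

(** The degrees decrease from n-1 to 0, so the determinant is the Vandermonde product of the l_i -
    l_j for i < j, divided by the product of the j! for j < n: Weyl's dimension formula. *)
Definition binmx (A : nzRingType) (n : nat) (l : nat -> nat) : 'M[A]_n :=
  \matrix_(i < n, j < n) ('C(l i, n - j.+1))%:R.

Lemma sum_bin_interval (A : nzRingType) (b r s lo hi : nat) :
    (lo <= hi <= b)%N ->
  \sum_(m < b.+1 | (lo <= m)%N && (m <= hi)%N) ('C(m + r, s))%:R
  = ('C(hi + r.+1, s.+1))%:R - ('C(lo + r, s.+1))%:R :> A.
Proof.
case/andP=> lo_hi hi_b.
transitivity (\sum_(lo <= m < hi.+1) ('C(m + r, s))%:R : A).
  rewrite (big_nat_widen _ _ b.+1) // big_geq_mkord /=.
  by apply: eq_bigl => i; rewrite ltnS andbC.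
rewrite (eq_bigr (fun m =>
  ('C(m.+1 + r, s.+1))%:R - ('C(m + r, s.+1))%:R : A)); last first.
  by move=> i _; rewrite addSn binS natrD addrC addKr.
by rewrite telescope_sumr ?(leqW lo_hi) // addSnnS.
Qed.

(** The unipotent matrix [U] subtracts from each row the next one. The last column, constantly 1,
    keeps only its bottom entry, and expanding along it leaves differences of binomials. By
    [sum_bin_interval], row [i] is then a sum over [mu i] between [la i.+1] and [la i], and
    multilinearity in the rows gives the sum over all [mu]. *)
Lemma det_binmx_branch (A : comNzRingType) (b n : nat) (la : nat -> nat) :
    {homo la : m p / (m <= p)%N >-> (p <= m)%N} -> (la 0 <= b)%N ->
  \det (binmx A n.+1 (shifted n.+1 la)) =
  \sum_(mu : {ffun 'I_n -> 'I_b.+1} | interlaced b.+1 n la mu)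
     \det (binmx A n (shifted n (padded b.+1 n mu))).
Proof.
move=> laD lab; pose M := binmx A n.+1 (shifted n.+1 la).
pose U : 'M[A]_n.+1 := \matrix_(i, j) ((i == j)%:R - (j == i.+1 :> nat)%:R).
have detU : \det U = 1.
  rewrite -det_tr det_trig; first by rewrite big1 // => i _; rewrite !mxE eqxx ltn_eqF // subr0.
  apply/is_trig_mxP => i j lt_ij; rewrite !mxE.
  have /negbTE-> : j != i by rewrite -val_eqE /= gtn_eqF.
  by rewrite ltn_eqF ?subr0 // (ltn_trans lt_ij).
have UM_max j : (U *m M) ord_max j = M ord_max j.
  rewrite mxE (bigD1 ord_max) //= big1 => [|i ni]; rewrite !mxE.
    by rewrite eqxx ltn_eqF // subr0 mul1r addr0.
  by rewrite eq_sym (negbTE ni) ltn_eqF ?subr0 ?mul0r.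
have UM_lt (i : 'I_n) j : (U *m M) (lift ord_max i) j =
    M (lift ord_max i) j - M (lift ord0 i) j.
  rewrite mxE (bigD1 (lift ord_max i)) //= (bigD1 (lift ord0 i)) /=; last first.
    by rewrite -val_eqE /= /bump; have := ltn_ord i; lia.
  rewrite big1 => [|p /andP[p1 p2]]; rewrite ![U _ _]mxE ?addr0.
    rewrite eqxx lift_max eqxx ltn_eqF // subr0 mul1r.
    have /negbTE-> : lift ord_max i != lift ord0 i.
      by rewrite -val_eqE /= /bump; have := ltn_ord i; lia.
    by rewrite sub0r mulN1r.
  move: p1 p2; rewrite eq_sym => /negbTE->.
  by rewrite lift_max -val_eqE /= /bump add1n => /negbTE->; rewrite subr0 mul0r.
have -> : \det M = \det (U *m M) by rewrite det_mulmx detU mul1r.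
rewrite (expand_det_col _ ord_max) big_ord_recr /= UM_max big1 ?add0r; last first.
  move=> i _; rewrite (_ : widen_ord _ i = lift ord_max i); last first.
    by apply: val_inj; rewrite [RHS]lift_max.
  by rewrite UM_lt !mxE /= subnn !bin0 subrr mul0r.
rewrite /cofactor -signr_odd oddD addbb mul1r !mxE /= subnn bin0 mul1r.
rewrite /determinant.
under [RHS]eq_bigr => mu _.
  under eq_bigr => s _ do under eq_bigr => i _ do rewrite mxE /shifted paddedE.
  over.
rewrite exchange_big /=; apply: eq_bigr => s _; rewrite -mulr_sumr; congr (_ * _).
pose Q (i : 'I_n) (m : 'I_b.+1) := (la i.+1 <= m)%N && (m <= la i)%N.
rewrite (eq_bigl (fun mu : {ffun 'I_n -> 'I_b.+1} => mu \in family Q)); last first.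
  by move=> mu; apply/forallP/familyP => H i; have := H i.
rewrite -(bigA_distr_big_dep Q
  (fun (i : 'I_n) (m : 'I_b.+1) => ('C(m + (n - i.+1), n - (s i).+1))%:R : A)).
apply: eq_bigr => i _.
rewrite [LHS]mxE [LHS]mxE UM_lt !mxE lift_max /shifted.
rewrite sum_bin_interval; last by rewrite laD //= (leq_trans (laD _ _ (leq0n i))).
by rewrite lift_max lift0 !subSS !subnSK.
Qed.

(** Both sides obey the same branching rule. The rectangle and the type ['I_B] of values stay fixed
    while [n] decreases, so the two rules match term by term. *)
Lemma card_filling (A : comNzRingType) (a b B n : nat) (la : nat -> nat) :
    {homo la : m p / (m <= p)%N >-> (p <= m)%N} ->
    (forall i, (n <= i)%N -> la i = 0%N) -> (la 0 <= b)%N ->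
    (n <= a)%N -> (n < B)%N ->
  (#|[set T | filling a b B n la T]|%SET)%:R = \det (binmx A n (shifted n la)).
Proof.
elim: n la => [|n IHn] la laD la0 lab n_a n_B.
  rewrite det_mx00 (_ : [set T | _] = [set [ffun => Ordinal n_B]])%SET ?cards1 //.
  apply/setP => T; rewrite !inE; apply/fillingP/eqP => [[T1 _ _ _]|->].
    apply/ffunP => -[i j]; rewrite ffunE; apply: val_inj => /=.
    by apply/eqP; rewrite -leqn0.
  by split => *; rewrite !ffunE //= la0.
rewrite filling_branch // natr_sum (det_binmx_branch A b) //.
apply: eq_bigr => mu mu_la.
have mu_laP := interlacedP _ _ _ _ laD la0 mu_la.
apply: IHn => [||||]; rewrite ?(ltnW n_a) ?(ltnW n_B) //.
- apply: (homo_leq (r := fun x y => (y <= x)%N)) => // [y x z|i].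
    by move=> ? /leq_trans; apply.
  have /andP[_ h] := mu_laP i.+1; have /andP[+ _] := mu_laP i.
  exact: leq_trans.
- by move=> i; apply: padded_ge.
- by apply: leq_trans lab; case/andP: (mu_laP 0).
Qed.

(** * Schur polynomials at 1^N as numbers of fillings *)

Lemma partition_nth_homo (la : seq nat) : is_partition la ->
  {homo nth 0%N la : m p / (m <= p)%N >-> (p <= m)%N}.
Proof.
case/andP=> la_sorted _ m p le_mp; have [p_la|/(nth_default 0%N)-> //] := ltnP p (size la).
apply: (sorted_leq_nth (leT := geq)) => //; rewrite ?inE //.
- by move=> x y z xy yz; apply: leq_trans yz xy.
- exact: leqnn.
- exact: leq_ltn_trans p_la.
Qed.

Lemma partition_nth_gt0 (la : seq nat) (i : nat) : is_partition la ->
  (0 < nth 0%N la i)%N = (i < size la)%N.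
Proof.
case/andP=> _ la0; have [i_la|/(nth_default 0%N)->//] := ltnP i (size la).
by rewrite lt0n; apply: contraNneq la0 => <-; apply: mem_nth.
Qed.

Lemma ydcell_inj (la : seq nat) (c d : ydcell la) :
  yrow c = yrow d -> ycol c = ycol d -> c = d.
Proof.
case: c d => [i j] [i' j']; rewrite /yrow /ycol /= => /val_inj e.
by case: i' / e j' => j' /val_inj->.
Qed.

Lemma ydcell_exists (la : seq nat) (i j : nat) : (j < nth 0%N la i)%N ->
  exists c : ydcell la, yrow c = i /\ ycol c = j.
Proof.
move=> j_lt; have i_lt : (i < size la)%N.
  by rewrite ltnNge; apply: contraTN j_lt => /(nth_default 0%N)->.
by exists (existT (fun i : 'I_(size la) => 'I_(nth 0%N la i)) (Ordinal i_lt) (Ordinal j_lt)).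
Qed.

Lemma ycol_lt (la : seq nat) (c : ydcell la) : (ycol c < nth 0%N la (yrow c))%N.
Proof. by case: c => i j; apply: ltn_ord. Qed.

Lemma yrow_lt (la : seq nat) (c : ydcell la) : (yrow c < size la)%N.
Proof. by case: c => i j; apply: ltn_ord. Qed.

Lemma semistandardP (la : seq nat) (N : nat) (T : {ffun ydcell la -> 'I_N}) :
  reflect ((forall c d : ydcell la, yrow c = yrow d -> (ycol c <= ycol d)%N ->
              (T c <= T d)%N) /\
           (forall c d : ydcell la, ycol c = ycol d -> (yrow c < yrow d)%N ->
              (T c < T d)%N))
    (semistandard T).
Proof.
apply: (iffP 'forall_forallP) => [H|[H1 H2] c d].
  split=> c d /eqP e h; have /andP[/implyP h1 /implyP h2] := H c d.
    by apply: h1; rewrite e.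
  by apply: h2; rewrite e.
by apply/andP; split; apply/implyP => /andP[/eqP]; [apply: H1 | apply: H2].
Qed.

Lemma schur1_card (A : comNzRingType) (N : nat) (la : seq nat) :
  schur la (fun _ : 'I_N => 1 : A) =
  (#|[set T : {ffun ydcell la -> 'I_N} | semistandard T]|%SET)%:R.
Proof.
rewrite /schur -sum1_card natr_sum; apply: eq_big => [T|T _]; first by rewrite inE.
by rewrite big1.
Qed.

(** The first column increases strictly, so its entry in row [N] would be at least [N]. *)
Lemma schur1_gt_size (A : comNzRingType) (N : nat) (la : seq nat) :
  is_partition la -> (N < size la)%N -> schur la (fun _ : 'I_N => 1 : A) = 0.
Proof.
move=> la_p N_la; rewrite schur1_card eq_card0 // => T; rewrite !inE.
apply/negP => /semistandardP[_ T_col].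
have T_ge i : (i < size la)%N -> forall c : ydcell la, yrow c = i -> ycol c = 0%N -> (i <= T c)%N.
  elim: i => [//|i IHi i_la c ci c0].
  have [|d [di d0]] := @ydcell_exists la i 0; first by rewrite partition_nth_gt0 // ltnW.
  apply: leq_ltn_trans (IHi (ltnW i_la) d di d0) _; apply: T_col; rewrite ?d0 ?c0 //.
  by rewrite di ci.
have [|c [cN c0]] := @ydcell_exists la N 0; first by rewrite partition_nth_gt0.
by have := T_ge N N_la c cN c0; rewrite leqNgt ltn_ord.
Qed.

(** A tableau is extended by [N] outside its diagram; conversely, a filling is read on the cells of
    the diagram, where its values lie below [N]. *)
Lemma card_semistandard (N b : nat) (la : seq nat) :
    is_partition la -> (size la <= N)%N -> (nth 0%N la 0 <= b)%N ->
  (#|[set T : {ffun ydcell la -> 'I_N} | semistandard T]|%SET =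
   #|[set T | filling N b N.+1 N (nth 0%N la) T]|%SET)%N.
Proof.
move=> la_p la_N la_b; have laD := partition_nth_homo la la_p.
have row_lt (c : ydcell la) : (yrow c < N)%N by apply: leq_trans (yrow_lt la c) la_N.
have col_lt (c : ydcell la) : (ycol c < b)%N.
  by apply: leq_trans (ycol_lt la c) _; apply: leq_trans la_b; apply: laD.
pose pos (c : ydcell la) : 'I_N * 'I_b := (Ordinal (row_lt c), Ordinal (col_lt c)).
pose f (T : {ffun ydcell la -> 'I_N}) : {ffun 'I_N * 'I_b -> 'I_N.+1} :=
  [ffun p => if [pick c | pos c == p] is Some c then widen_ord (leqnSn N) (T c)
             else ord_max].
have pos_inj c d : pos c = pos d -> c = d.
  by case=> *; apply: ydcell_inj.
have f_pos T c : f T (pos c) = T c :> nat.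
  rewrite ffunE; case: pickP => [d /eqP/pos_inj-> //|/(_ c)].
  by rewrite eqxx.
have pos_ex (i : 'I_N) (j : 'I_b) : (j < nth 0%N la i)%N -> exists c, (i, j) = pos c.
  by case/ydcell_exists => c [ci cj]; exists c; congr pair; apply: val_inj.
have f_out T (i : 'I_N) (j : 'I_b) : (nth 0%N la i <= j)%N -> f T (i, j) = N :> nat.
  move=> out; rewrite ffunE; case: pickP => // c /eqP[ci cj].
  by move: out; rewrite -ci -cj leqNgt ycol_lt.
rewrite -(@card_in_imset _ _ f) => [|T T' _ _ /ffunP e]; last first.
  by apply/ffunP => c; apply: val_inj; rewrite /= -f_pos e f_pos.
apply: eq_card => T'; rewrite inE; apply/imsetP/fillingP.
  case=> T; rewrite inE => /semistandardP[T_row T_col] ->.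
  have fN p : (f T p <= N)%N by rewrite -ltnS.
  split=> [i j|i j|i j j' le_j|i i' j lt_i]; rewrite ?fN //.
  - have [/pos_ex[c ->]|out] := ltnP j (nth 0%N la i); first by rewrite f_pos ltn_ord.
    by rewrite f_out // ltnn.
  - have [lt_j'|out] := ltnP j' (nth 0%N la i); last by rewrite (f_out _ _ j').
    have lt_j := leq_ltn_trans le_j lt_j'.
    have [c ec] := pos_ex _ _ lt_j; have [d ed] := pos_ex _ _ lt_j'.
    rewrite ec ed !f_pos; case: ec ed le_j => -> -> [e ->]; exact: T_row.
  - have [lt_j _|out] := ltnP j (nth 0%N la i); last by rewrite f_out ?ltnn.
    have [c ec] := pos_ex _ _ lt_j.
    have [lt_j'|out] := ltnP j (nth 0%N la i'); last by rewrite ec f_pos f_out.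
    have [d ed] := pos_ex _ _ lt_j'.
    rewrite ec ed !f_pos; case: ec ed lt_i => -> -> [-> e]; exact: T_col.
case=> T1 T2 T3 T4.
have Tpos c : (T' (pos c) < N)%N by rewrite T2; apply: ycol_lt.
exists [ffun c => Ordinal (Tpos c)]; last first.
  apply/ffunP => -[i j]; apply: val_inj => /=.
  have [/pos_ex[c ->]|out] := ltnP j (nth 0%N la i); first by rewrite f_pos ffunE.
  by rewrite f_out //; apply/eqP; rewrite eqn_leq T1 leqNgt T2 -leqNgt.
rewrite inE; apply/semistandardP; split=> c d e h; rewrite !ffunE /=.
  rewrite /pos; set x := Ordinal _; set x' := Ordinal (row_lt d).
  by have -> : x = x' by [apply: val_inj]; apply: T3.
have := T4 (pos c).1 (pos d).1 (pos c).2 h (Tpos c).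
by rewrite [((pos d).1, _)](_ : _ = pos d) //; congr pair; apply: val_inj.
Qed.

Lemma schur1_det (A : comNzRingType) (N : nat) (la : seq nat) :
    is_partition la -> (size la <= N)%N ->
  schur la (fun _ : 'I_N => 1 : A) = \det (binmx A N (shifted N (nth 0%N la))).
Proof.
move=> la_p la_N; rewrite schur1_card (card_semistandard N (nth 0%N la 0)) //.
apply: card_filling => //; first exact: partition_nth_homo.
by move=> i N_i; rewrite nth_default // (leq_trans la_N).
Qed.

(** * Meixner polynomials and their moments *)

(* For [e = - q / (1 - q)] and up to a factor, the Meixner polynomial with
   beta = 1 and weight [q ^+ x]; the normalization makes it unitriangular in the
   binomials ['C(x, j)]. *)
Definition meixner (A : nzRingType) (e : A) (n x : nat) : A :=
  \sum_(j < n.+1) ('C(x, j) * 'C(n, j))%:R * e ^+ (n - j).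

Lemma meixner0 (A : nzRingType) (e : A) (x : nat) : meixner A e 0 x = 1.
Proof. by rewrite /meixner big_ord1 !bin0 expr0 mulr1. Qed.

Lemma meixner_diff (A : comNzRingType) (e : A) (n x : nat) :
  meixner A e n x.+1 - meixner A e n x =
  \sum_(j < n) ('C(x, j) * 'C(n, j.+1))%:R * e ^+ (n - j.+1).
Proof.
rewrite /meixner -sumrB big_ord_recl /= !bin0 subrr add0r.
apply: eq_bigr => j _; rewrite -mulrBl /bump /= add1n binS mulnDl natrD.
by rewrite addrC addKr.
Qed.

(** The generating function of the polynomials in [n] is (1 + (1-e) t)^x / (1 - e t)^(x+1); raising
    [x] by one multiplies it by (1 + (1-e) t) / (1 - e t). *)
Lemma meixner_rec (A : comNzRingType) (e : A) (n x : nat) :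
  meixner A e n.+1 x.+1 - e * meixner A e n x.+1 =
  meixner A e n.+1 x + (1 - e) * meixner A e n x.
Proof.
suff : meixner A e n.+1 x.+1 - meixner A e n.+1 x =
    meixner A e n x + e * (meixner A e n x.+1 - meixner A e n x).
  by move/eqP; rewrite subr_eq => /eqP ->; ring.
rewrite !meixner_diff big_ord_recr [meixner A e n x]big_ord_recr /=.
rewrite !subnn !expr0 !mulr1 !binn mulr_sumr addrAC -big_split /=.
congr (_ + _); apply: eq_bigr => j _.
rewrite subSS mulrCA -exprS subnSK // -mulrDl -natrD -mulnDr binS.
by rewrite addnC.
Qed.

Lemma meixner_bin (A : comNzRingType) (e : A) (M n x : nat) : (n < M)%N ->
  meixner A e n x = \sum_(j < M) ('C(x, j))%:R * (('C(n, j))%:R * e ^+ (n - j)).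
Proof.
move=> n_M; rewrite /meixner.
rewrite (big_ord_widen M (fun j => ('C(x, j) * 'C(n, j))%:R * e ^+ (n - j))) //.
rewrite big_mkcond; apply: eq_bigr => j _ /=; rewrite mulrA -natrM.
by case: ltnP => // /bin_small ->; rewrite muln0 mul0r.
Qed.

Lemma det_meixner (A : comNzRingType) (e : A) (N : nat) (l : nat -> nat) :
  \det (\matrix_(i < N, j < N) meixner A e (N - j.+1) (l i)) = \det (binmx A N l).
Proof.
(* The change of basis from binomials to Meixner polynomials. Degrees decrease along the columns, so
   it is lower unitriangular. *)
pose Z : 'M[A]_N := \matrix_(a, j)
  (('C(N - j.+1, N - a.+1))%:R * e ^+ ((N - j.+1) - (N - a.+1))).
have detZ : \det Z = 1.
  rewrite det_trig; last first.
    apply/is_trig_mxP => i j lt_ij; rewrite mxE bin_small ?mul0r //.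
    by have := ltn_ord j; lia.
  by rewrite big1 // => i _; rewrite mxE binn subnn mulr1.
rewrite -[RHS]mulr1 -detZ -det_mulmx; congr (\det _); apply/matrixP => i j.
rewrite !mxE (meixner_bin _ _ N); last by have := ltn_ord j; lia.
rewrite (reindex_inj rev_ord_inj) /=; apply: eq_bigr => a _.
by rewrite !mxE.
Qed.

(** Growth slower than every exponential: enough to kill the boundary terms, and stable under sums
    and products without any tracking of degrees. *)
Definition subexp (R : realType) (f : nat -> R) : Prop :=
  forall r : R, 0 < r -> r < 1 -> (fun L => r ^+ L * f L) @ \oo --> (0 : R).

Lemma subexp_cst (R : realType) (c : R) : subexp R (fun=> c).
Proof.
move=> r r0 r1; rewrite -[0](mul0r c).
by apply: cvgM; [apply: cvg_expr; rewrite gtr0_norm | exact: cvg_cst].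
Qed.

Lemma subexpD (R : realType) (f g : nat -> R) :
  subexp R f -> subexp R g -> subexp R (fun L => f L + g L).
Proof.
move=> hf hg r r0 r1; rewrite -[0](addr0 0).
under eq_fun do rewrite mulrDr.
by apply: cvgD; [apply: hf | apply: hg].
Qed.

Lemma subexpM (R : realType) (f g : nat -> R) :
  subexp R f -> subexp R g -> subexp R (fun L => f L * g L).
Proof.
move=> hf hg r r0 r1; rewrite -[0](mulr0 0).
(* Splitting [r] into two square roots gives each factor its own decaying exponential. *)
have s0 : 0 < Num.sqrt r by rewrite sqrtr_gt0.
have s1 : Num.sqrt r < 1 by rewrite -sqrtr1 ltr_sqrt.
under eq_fun => L.
  rewrite -[X in X ^+ _](sqr_sqrtr (ltW r0)) expr2 exprMn mulrACA.
  over.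
by apply: cvgM; [apply: hf | apply: hg].
Qed.

Lemma subexp_nat (R : realType) : subexp R (fun L => L%:R).
Proof.
move=> r r0 r1; pose s := Num.sqrt r.
have s0 : 0 < s by rewrite sqrtr_gt0.
have s1 : s < 1 by rewrite -sqrtr1 ltr_sqrt.
have h0 : 0 < s^-1 - 1 by rewrite subr_gt0 invf_gt1.
(* A Bernoulli inequality bounds [s ^+ L * L%:R]; the other factor [s ^+ L] of [r ^+ L] tends to
   0. *)
have le_s L : s ^+ L * L%:R <= (s^-1 - 1)^-1.
  rewrite -ler_pdivlMl ?exprn_gt0 // -exprVn ler_pdivlMr //.
  have : forall M, M%:R * (s^-1 - 1) <= s^-1 ^+ M.
    elim=> [|M IHM]; first by rewrite mul0r.
    rewrite exprS -natr1 mulrDl mul1r.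
    have : 1 <= s^-1 ^+ M by rewrite exprn_ege1 // ltW // invf_gt1.
    by nra.
  exact.
apply: (@squeeze_cvgr _ _ _ _ (fun=> 0) (fun L => s ^+ L * (s^-1 - 1)^-1)).
- near=> L; rewrite mulr_ge0 ?exprn_ge0 ?ler0n ?(ltW r0) //=.
  rewrite -[X in X ^+ _](sqr_sqrtr (ltW r0)) expr2 exprMn -mulrA.
  by rewrite ler_wpM2l // exprn_ge0 // ltW.
- exact: cvg_cst.
- exact: (subexp_cst R).
Unshelve. all: by end_near.
Qed.

Lemma subexp_bin (R : realType) (a : nat) : subexp R (fun L => ('C(L, a))%:R).
Proof.
elim: a => [|a IHa].
  by move=> r r0 r1; under eq_fun do rewrite bin0; apply: (subexp_cst R).
rewrite (_ : (fun L => _) =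
    (fun L => (a.+1%:R)^-1 * ((L%:R + (- a%:R)) * ('C(L, a))%:R))).
  apply: (subexpM R _ _ (subexp_cst R _)); apply: subexpM => //.
  by apply: subexpD; [exact: subexp_nat | exact: subexp_cst].
apply/funext => L; apply: (mulfI (x := a.+1%:R)); first by rewrite pnatr_eq0.
rewrite mulrA divff ?pnatr_eq0 // mul1r -natrM.
have [lt_La|le_aL] := ltnP L a; first by rewrite !bin_small ?muln0 ?mulr0 // ltnW.
by rewrite mul_bin_left natrM natrB.
Qed.

Lemma subexp_sum (R : realType) (n : nat) (f : 'I_n -> nat -> R) :
  (forall i, subexp R (f i)) -> subexp R (fun L => \sum_i f i L).
Proof.
elim: n f => [|n IHn] f hf.
  rewrite (_ : (fun L => _) = (fun=> 0)); first exact: subexp_cst.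
  by apply/funext => L; rewrite big_ord0.
rewrite (_ : (fun L => _) =
    (fun L => f ord0 L + \sum_(i < n) f (lift ord0 i) L)).
  by apply: subexpD => //; apply: IHn.
by apply/funext => L; rewrite big_ord_recl.
Qed.

Lemma subexp_meixner (R : realType) (e : R) (n : nat) : subexp R (meixner R e n).
Proof.
rewrite (_ : meixner R e n = fun x => \sum_(j < n.+1) ('C(x, j))%:R *
    (('C(n, j))%:R * e ^+ (n - j))); last first.
  by apply/funext => x; apply: meixner_bin.
by apply: subexp_sum => i; apply: subexpM; [exact: subexp_bin | exact: subexp_cst].
Qed.

(* [meixner e (n - 1)], and [0] for [n = 0]; [moment], [mcoef] and [mlim] use the
   same shift of the indices, which spares the recurrences any side condition. *)
Definition meixnerS (A : nzRingType) (e : A) (n x : nat) : A :=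
  if n is n'.+1 then meixner A e n' x else 0.

Lemma meixnerS_rec (A : comNzRingType) (e : A) (n x : nat) :
  meixnerS A e n.+1 x.+1 - e * meixnerS A e n x.+1 =
  meixnerS A e n.+1 x + (1 - e) * meixnerS A e n x.
Proof.
case: n => [|n] /=; last exact: meixner_rec.
by rewrite !meixner0 !mulr0 addr0 subr0.
Qed.

Lemma subexp_meixnerS (R : realType) (e : R) (n : nat) : subexp R (meixnerS R e n).
Proof. by case: n => [|n]; [exact: subexp_cst | exact: subexp_meixner]. Qed.

Lemma sum_geom_shift (A : comNzRingType) (q : A) (g : nat -> A) (L : nat) :
  \sum_(x < L) q ^+ x.+1 * g x.+1 = \sum_(x < L) q ^+ x * g x - g 0%N + q ^+ L * g L.
Proof.
have e : \sum_(x < L.+1) q ^+ x * g x = \sum_(x < L) q ^+ x * g x + q ^+ L * g L.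
  by rewrite big_ord_recr.
move: e; rewrite big_ord_recl expr0 mul1r /= => e.
by rewrite addrAC -e addrAC subrr add0r.
Qed.

(** The partial sum up to [L] of A_k(n-1, m-1). The parameter e = -q/(1-q) of the polynomials
    satisfies 1 - e = y. *)
Definition moment (R : realType) (q : R) (k n m L : nat) : R :=
  \sum_(x < L) q ^+ x * (('C(x, k))%:R *
    (meixnerS R (- (q / (1 - q))) n x * meixnerS R (- (q / (1 - q))) m x)).

(* The term left at the upper end by the summation by parts in [moment_rec]. *)
Definition boundary (R : realType) (q : R) (k n m L : nat) : R :=
  let e := - (q / (1 - q)) in
  q ^+ L * (('C(L, k))%:R * ((meixnerS R e n.+1 L - e * meixnerS R e n L) *
     (meixnerS R e m.+1 L - e * meixnerS R e m L))).

Lemma boundary_cvg (R : realType) (q : R) (k n m : nat) : 0 < q -> q < 1 ->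
  boundary R q k n m @ \oo --> (0 : R).
Proof.
move=> q0 q1.
have h p : subexp R (fun L => meixnerS R (- (q / (1 - q))) p.+1 L +
    (q / (1 - q)) * meixnerS R (- (q / (1 - q))) p L).
  apply: subexpD; first exact: subexp_meixnerS.
  by apply: subexpM; [exact: subexp_cst | exact: subexp_meixnerS].
rewrite /boundary; under eq_fun do rewrite !mulNr !opprK.
have := subexpM R _ _ (subexp_bin R k) (subexpM R _ _ (h n) (h m)).
exact.
Qed.

(** The sum of [q ^+ x * g x] is expanded directly and, after shifting [x], through [meixnerS_rec]
    and Pascal's rule. Since q (1 - e) = -e, the mixed moments of order [k.+1] occur equally on both
    sides and cancel. *)
Lemma moment_rec (R : realType) (q : R) (k n m L : nat) : q < 1 ->
  moment R q k.+1 n.+1 m.+1 L =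
  q * (1 - q)^-1 ^+ 2 * moment R q k.+1 n m L +
  (1 - q)^-1 * (q * (moment R q k n.+1 m.+1 L + (1 - q)^-1 * moment R q k n m.+1 L
    + (1 - q)^-1 * moment R q k n.+1 m L + (1 - q)^-1 ^+ 2 * moment R q k n m L)
    - boundary R q k.+1 n m L).
Proof.
move=> q1; have q1' : 1 - q != 0 by rewrite subr_eq0 gt_eqF.
set y := (1 - q)^-1; pose e := - (q / (1 - q)).
have ye : 1 - e = y by rewrite /e /y; field.
pose S := meixnerS R e.
pose g x := ('C(x, k.+1))%:R * ((S n.+1 x - e * S n x) * (S m.+1 x - e * S m x)).
have := sum_geom_shift R q g L.
have -> : g 0%N = 0 by rewrite /g bin_small // mul0r.
rewrite subr0 -[q ^+ L * g L]/(boundary R q k.+1 n m L).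
have -> : \sum_(x < L) q ^+ x * g x = moment R q k.+1 n.+1 m.+1 L -
   e * moment R q k.+1 n m.+1 L - e * moment R q k.+1 n.+1 m L +
   e ^+ 2 * moment R q k.+1 n m L.
  rewrite /moment !mulr_sumr -!sumrB -big_split /=; apply: eq_bigr => x _.
  by rewrite /g /S -/e /=; ring.
have -> : \sum_(x < L) q ^+ x.+1 * g x.+1 =
   q * ((moment R q k.+1 n.+1 m.+1 L +
     y * moment R q k.+1 n m.+1 L + y * moment R q k.+1 n.+1 m L +
     y ^+ 2 * moment R q k.+1 n m L) +
   (moment R q k n.+1 m.+1 L +
     y * moment R q k n m.+1 L + y * moment R q k n.+1 m L +
     y ^+ 2 * moment R q k n m L)).
  rewrite /moment !mulr_sumr -!big_split /= mulr_sumr; apply: eq_bigr => x _.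
  by rewrite /g /S !meixnerS_rec binS natrD ye exprS -/e /=; ring.
set B := boundary _ _ _ _ _ _.
move/eqP; rewrite -subr_eq0 => /eqP h; apply/eqP; rewrite -subr_eq0.
(* The difference of the two sides of the goal is [- y] times the left side of [h]. *)
set lhs := (X in X == 0); have -> : lhs = - y * 0; last by rewrite mulr0.
by rewrite -h /lhs /e /y; field.
Qed.

Lemma meixner_at0 (A : comNzRingType) (e : A) (n : nat) : meixner A e n 0 = e ^+ n.
Proof.
rewrite /meixner big_ord_recl /= !bin0 subn0 mul1r big1 ?addr0 // => j _.
by rewrite bin0n mul0r.
Qed.

Lemma meixnerS_at0 (A : comNzRingType) (e : A) (n : nat) :
  meixnerS A e n.+1 0 - e * meixnerS A e n 0 = (n == 0)%:R.
Proof.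
case: n => [|n] /=; first by rewrite meixner0 mulr0 subr0.
by rewrite !meixner_at0 exprS subrr.
Qed.

(** Same summation by parts, but [g] no longer vanishes at 0: its value there, nonzero only for n =
    m = 0, replaces the moments of lower order. *)
Lemma moment_rec0 (R : realType) (q : R) (n m L : nat) : q < 1 ->
  moment R q 0 n.+1 m.+1 L =
  q * (1 - q)^-1 ^+ 2 * moment R q 0 n m L +
  (1 - q)^-1 * (((n == 0) && (m == 0))%:R - boundary R q 0 n m L).
Proof.
move=> q1; have q1' : 1 - q != 0 by rewrite subr_eq0 gt_eqF.
set y := (1 - q)^-1; pose e := - (q / (1 - q)).
have ye : 1 - e = y by rewrite /e /y; field.
pose S := meixnerS R e.
pose g x := ('C(x, 0))%:R * ((S n.+1 x - e * S n x) * (S m.+1 x - e * S m x)).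
have := sum_geom_shift R q g L.
have -> : g 0%N = ((n == 0) && (m == 0))%:R.
  by rewrite /g mul1r !meixnerS_at0 -natrM mulnb.
rewrite -[q ^+ L * g L]/(boundary R q 0 n m L).
have -> : \sum_(x < L) q ^+ x * g x = moment R q 0 n.+1 m.+1 L -
   e * moment R q 0 n m.+1 L - e * moment R q 0 n.+1 m L +
   e ^+ 2 * moment R q 0 n m L.
  rewrite /moment !mulr_sumr -!sumrB -big_split /=; apply: eq_bigr => x _.
  by rewrite /g /S -/e /=; ring.
have -> : \sum_(x < L) q ^+ x.+1 * g x.+1 =
   q * (moment R q 0 n.+1 m.+1 L +
     y * moment R q 0 n m.+1 L + y * moment R q 0 n.+1 m L +
     y ^+ 2 * moment R q 0 n m L).
  rewrite /moment !mulr_sumr -!big_split /= mulr_sumr; apply: eq_bigr => x _.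
  by rewrite /g /S !meixnerS_rec !bin0 ye exprS -/e /=; ring.
set B := boundary _ _ _ _ _ _; set d := (_ && _)%:R.
move/eqP; rewrite -subr_eq0 => /eqP h; apply/eqP; rewrite -subr_eq0.
set lhs := (X in X == 0); have -> : lhs = - y * 0; last by rewrite mulr0.
by rewrite -h /lhs /e /y; field.
Qed.

(** The coefficient of t^(n-1-p) in (1 + y t)^k. The test excludes n <= p, where the truncated
    subtraction would read as degree 0. *)
Definition mcoef (A : nzRingType) (y : A) (k n p : nat) : A :=
  if (p < n)%N then y ^+ (n.-1 - p) * ('C(k, n.-1 - p))%:R else 0.

Lemma mcoefSS (A : nzRingType) (y : A) (k n p : nat) :
  mcoef A y k n.+1 p.+1 = mcoef A y k n p.
Proof. by case: n => //= n; rewrite /mcoef !ltnS /= subSS. Qed.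

Lemma mcoefSk (A : comNzRingType) (y : A) (k n p : nat) :
  mcoef A y k.+1 n.+1 p = mcoef A y k n.+1 p + y * mcoef A y k n p.
Proof.
rewrite /mcoef /= ltnS; have [lt_pn|lt_np|->] := ltngtP p n.
- have -> : (n - p = (n.-1 - p).+1)%N by lia.
  by rewrite binS natrD exprS; ring.
- by rewrite mulr0 addr0.
- by rewrite subnn !bin0 mulr0 addr0.
Qed.

(** The closed form of A_k(n-1, m-1) without its factor q^k y^(k+1): the coefficient of t^(n-1)
    u^(m-1) in (1 + y t)^k (1 + y u)^k / (1 - q y^2 t u)^(k+1). *)
Definition mlim (A : nzRingType) (q y : A) (k n m : nat) : A :=
  \sum_(p < n) mcoef A y k n p * mcoef A y k m p * ('C(p + k, k))%:R
     * (q * y ^+ 2) ^+ p.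

Lemma mlim_rec0 (A : comNzRingType) (q y : A) (n m : nat) :
  mlim A q y 0 n.+1 m.+1 = q * y ^+ 2 * mlim A q y 0 n m + ((n == 0) && (m == 0))%:R.
Proof.
rewrite /mlim big_ord_recl /= mulr_sumr addrC; congr (_ + _).
  apply: eq_bigr => i _; rewrite /bump /= add1n !mcoefSS !bin0 exprS; ring.
rewrite expr0 !mulr1 /mcoef /= !subn0 !bin0n.
by case: n => [|n]; case: m => [|m]; rewrite ?mulr0 ?mul0r ?mulr1.
Qed.

(** Multiplying the generating function for k+1 by 1 - q y^2 t u gives (1 + y t) (1 + y u) times the
    one for k. On coefficients, this is Pascal's rule for ['C(p + k.+1, k.+1)] and for both
    [mcoef]. *)
Lemma mlim_rec (A : comNzRingType) (q y : A) (k n m : nat) :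
  mlim A q y k.+1 n.+1 m.+1 = q * y ^+ 2 * mlim A q y k.+1 n m +
    (mlim A q y k n.+1 m.+1 + y * mlim A q y k n m.+1
    + y * mlim A q y k n.+1 m + y ^+ 2 * mlim A q y k n m).
Proof.
have widen m' : mlim A q y k n m' = \sum_(p < n.+1)
    mcoef A y k n p * mcoef A y k m' p * ('C(p + k, k))%:R * (q * y ^+ 2) ^+ p.
  by rewrite big_ord_recr /= {3}/mcoef ltnn !mul0r addr0.
rewrite !widen.
have -> : mlim A q y k.+1 n.+1 m.+1 =
  \sum_(p < n.+1) mcoef A y k.+1 n.+1 p * mcoef A y k.+1 m.+1 p
      * ('C(p + k, k.+1))%:R * (q * y ^+ 2) ^+ p +
  \sum_(p < n.+1) mcoef A y k.+1 n.+1 p * mcoef A y k.+1 m.+1 p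
      * ('C(p + k, k))%:R * (q * y ^+ 2) ^+ p.
  rewrite -big_split /=; apply: eq_bigr => p _.
  by rewrite addnS binS natrD; ring.
congr (_ + _).
  rewrite big_ord_recl /= add0n bin_small // mulr0 mul0r add0r /mlim mulr_sumr.
  apply: eq_bigr => p _; rewrite /bump /= add1n !mcoefSS exprS addSnnS; ring.
rewrite /mlim !mulr_sumr -!big_split /=; apply: eq_bigr => p _.
by rewrite !mcoefSk; ring.
Qed.

(** Moments and their claimed limits obey the same recurrences, up to boundary terms that tend to 0,
    and both vanish at n = 0 or m = 0. *)
Lemma moment_cvg (R : realType) (q : R) (k n m : nat) : 0 < q -> q < 1 ->
  moment R q k n m @ \oo -->
    (q ^+ k * (1 - q)^-1 ^+ k.+1 * mlim R q (1 - q)^-1 k n m : R).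
Proof.
move=> q0 q1; set y := (1 - q)^-1.
elim: k n m => [|k IHk] n m.
  elim: n m => [|n IHn] m.
    rewrite /mlim big_ord0 mulr0 (_ : moment _ _ _ _ _ = fun=> 0); first exact: cvg_cst.
    by apply/funext => L; rewrite /moment big1 // => x _; rewrite /= mul0r !mulr0.
  case: m => [|m].
    rewrite (_ : mlim _ _ _ _ _ _ = 0) ?mulr0; last first.
      by rewrite /mlim big1 // => p _; rewrite {2}/mcoef ltn0 mulr0 !mul0r.
    rewrite (_ : moment _ _ _ _ _ = fun=> 0); first exact: cvg_cst.
    by apply/funext => L; rewrite /moment big1 // => x _; rewrite /= !mulr0.
  rewrite (funext (fun L => moment_rec0 R q n m L q1)).
  rewrite mlim_rec0 -/y.
  (* The limit is put in the shape of the recurrence, with 0 for the limit of the boundary term. *)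
  have -> (d v : R) : q ^+ 0 * y ^+ 1 * (q * y ^+ 2 * v + d) =
      q * y ^+ 2 * (q ^+ 0 * y ^+ 1 * v) + y * (d - 0) by ring.
  apply: cvgD; apply: cvgM; [exact: cvg_cst|exact: IHn|exact: cvg_cst|].
  by apply: cvgB; [exact: cvg_cst | exact: boundary_cvg].
elim: n m => [|n IHn] m.
  rewrite /mlim big_ord0 mulr0 (_ : moment _ _ _ _ _ = fun=> 0); first exact: cvg_cst.
  by apply/funext => L; rewrite /moment big1 // => x _; rewrite /= mul0r !mulr0.
case: m => [|m].
  rewrite (_ : mlim _ _ _ _ _ _ = 0) ?mulr0; last first.
    by rewrite /mlim big1 // => p _; rewrite {2}/mcoef ltn0 mulr0 !mul0r.
  rewrite (_ : moment _ _ _ _ _ = fun=> 0); first exact: cvg_cst.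
  by apply/funext => L; rewrite /moment big1 // => x _; rewrite /= !mulr0.
rewrite (funext (fun L => moment_rec R q k n m L q1)).
rewrite mlim_rec -/y.
have -> (a b c d f : R) : q ^+ k.+1 * y ^+ k.+2 *
    (q * y ^+ 2 * a + (b + y * c + y * d + y ^+ 2 * f)) =
  q * y ^+ 2 * (q ^+ k.+1 * y ^+ k.+2 * a) +
  y * (q * ((q ^+ k * y ^+ k.+1 * b) + y * (q ^+ k * y ^+ k.+1 * c) +
   y * (q ^+ k * y ^+ k.+1 * d) + y ^+ 2 * (q ^+ k * y ^+ k.+1 * f)) - 0).
  by rewrite !exprS; ring.
apply: cvgD; apply: cvgM; [exact: cvg_cst|exact: IHn|exact: cvg_cst|].
apply: cvgB; last exact: boundary_cvg.
apply: cvgM; first exact: cvg_cst.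
apply: cvgD; [apply: cvgD; [apply: cvgD; [exact: IHk|]|]|];
  by apply: cvgM; [exact: cvg_cst | exact: IHk].
Qed.

(** * Symmetrization and Andreief's identity *)

Definition strictly_decr (N L : nat) (l : {ffun 'I_N -> 'I_L}) : bool :=
  [forall i : 'I_N, forall j : 'I_N, (i < j)%N ==> (l j < l i)%N].

Lemma strictly_decrP (N L : nat) (l : {ffun 'I_N -> 'I_L}) :
  reflect (forall i j : 'I_N, (i < j)%N -> (l j < l i)%N) (strictly_decr N L l).
Proof.
by apply: (iffP 'forall_forallP) => H i j; apply/implyP; apply: H.
Qed.

Definition permute (N L : nat) (s : 'S_N) (l : {ffun 'I_N -> 'I_L}) :
  {ffun 'I_N -> 'I_L} := [ffun i => l (s i)].

Lemma permute_inj (N L : nat) (s : 'S_N) : injective (permute N L s).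
Proof.
move=> l l' /ffunP e; apply/ffunP => i.
by have := e (s^-1%g i); rewrite !ffunE permKV.
Qed.

Lemma strictly_decr_permute (N L : nat) (l : {ffun 'I_N -> 'I_L}) :
  injective l -> exists s : 'S_N, strictly_decr N L (permute N L s l).
Proof.
move=> l_inj; pose r (x y : 'I_L) := (y <= x)%N.
have r_total : total r by move=> x y; apply: leq_total.
have r_trans : transitive r by move=> x y z xy yz; apply: leq_trans yz xy.
pose t := [tuple l i | i < N].
have : perm_eq (sort r t) t by rewrite perm_sort.
case/tuple_permP => s es; exists s; apply/strictly_decrP => i j lt_ij.
have := sort_sorted r_total t; rewrite es => t_sorted.
have := sorted_ltn_nth r_trans (l i) t_sorted; rewrite size_tuple => h.
have := h i j (ltn_ord i) (ltn_ord j) lt_ij.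
rewrite /r -!tnth_nth !tnth_mktuple => le_l; rewrite !ffunE ltn_neqAle le_l andbT.
by apply: contraTneq lt_ij => /val_inj/l_inj/perm_inj->; rewrite ltnn.
Qed.

Lemma strictly_decr_permute_uniq (N L : nat) (l : {ffun 'I_N -> 'I_L}) (s t : 'S_N) :
    injective l -> strictly_decr N L (permute N L s l) ->
  strictly_decr N L (permute N L t l) -> s = t.
Proof.
move=> l_inj ds dt; pose r (x y : 'I_L) := (y < x)%N.
have r_sorted u : strictly_decr N L (permute N L u l) ->
    sorted r [seq l (u i) | i <- enum 'I_N].
  move=> /strictly_decrP du; rewrite sorted_map.
  apply: (@sub_sorted _ (relpre val ltn)) => [i j /du|].
    by rewrite !ffunE.
  by rewrite -sorted_map val_enum_ord iota_ltn_sorted.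
have e : [seq l (s i) | i <- enum 'I_N] = [seq l (t i) | i <- enum 'I_N].
  apply: (irr_sorted_eq (leT := r)); rewrite ?r_sorted //.
  - by move=> x y z xy yz; apply: ltn_trans yz xy.
  - by move=> x; apply: ltnn.
  - move=> x; apply/mapP/mapP => -[i _ ->].
      by exists (t^-1%g (s i)); rewrite ?mem_enum // permKV.
    by exists (s^-1%g (t i)); rewrite ?mem_enum // permKV.
by apply/permP => i; apply/l_inj; move/eq_in_map: e; apply; rewrite mem_enum.
Qed.

(** An injective [l] has exactly one decreasing rearrangement, so each value on a decreasing [l] is
    counted once per permutation. *)
Lemma sum_symmetric (A : comNzRingType) (N L : nat) (t : {ffun 'I_N -> 'I_L} -> A) :
    (forall s l, t (permute N L s l) = t l) ->
    (forall l : {ffun 'I_N -> 'I_L}, ~ injective l -> t l = 0) ->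
  \sum_l t l = N`!%:R * \sum_(l | strictly_decr N L l) t l.
Proof.
move=> t_sym t_inj.
transitivity (\sum_(s : 'S_N) \sum_(l | strictly_decr N L (permute N L s l))
    t (permute N L s l)).
  under [RHS]eq_bigr do rewrite big_mkcond.
  rewrite exchange_big /=; apply: eq_bigr => l _.
  have [/injectiveP l_inj|/injectiveP l_ninj] := boolP (injectiveb l); last first.
    by rewrite t_inj // big1 // => s _; case: ifP => // _; rewrite t_sym t_inj.
  have [s ds] := strictly_decr_permute N L l l_inj.
  rewrite (bigD1 s) //= ds big1 ?addr0 // => u us.
  case: ifP => // du; move: us.
  by rewrite (strictly_decr_permute_uniq _ _ _ _ _ l_inj du ds) eqxx.
rewrite (eq_bigr (fun=> \sum_(l | strictly_decr N L l) t l)).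
  by rewrite sumr_const mulr_natl card_Sn.
by move=> s _; rewrite [RHS](reindex_inj (permute_inj N L s)).
Qed.

Definition evalmx (A : comNzRingType) (N L : nat) (phi : 'I_N -> 'I_L -> A)
    (l : {ffun 'I_N -> 'I_L}) : 'M[A]_N := \matrix_(i, j) phi j (l i).

Lemma det_evalmx_permute (A : comNzRingType) (N L : nat) (phi : 'I_N -> 'I_L -> A)
    (s : 'S_N) (l : {ffun 'I_N -> 'I_L}) :
  \det (evalmx A N L phi (permute N L s l)) = (-1) ^+ s * \det (evalmx A N L phi l).
Proof.
rewrite -det_perm -det_mulmx -row_permE; congr (\det _).
by apply/matrixP => i j; rewrite !mxE ffunE.
Qed.

Lemma det_evalmx_noninj (A : comNzRingType) (N L : nat) (phi : 'I_N -> 'I_L -> A)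
    (l : {ffun 'I_N -> 'I_L}) :
  ~ injective l -> \det (evalmx A N L phi l) = 0.
Proof.
move/injectiveP/injectivePn => [i [j ij lij]].
by apply: (determinant_alternate ij) => k; rewrite !mxE lij.
Qed.

(* Andreief's identity for the weight [(1 + t f) w], differentiated at t = 0. *)
Lemma sum_det_sqr (A : comNzRingType) (N L : nat) (f w : 'I_L -> A)
    (phi : 'I_N -> 'I_L -> A) :
  \sum_(l : {ffun 'I_N -> 'I_L}) (\sum_m f (l m)) * (\prod_i w (l i)) *
      \det (evalmx A N L phi l) ^+ 2
  = N`!%:R * \sum_m \det (\matrix_(i < N, j < N)
      \sum_x (if i == m then f x else 1) * w x * phi i x * phi j x).
Proof.
pose t (l : {ffun 'I_N -> 'I_L}) :=
  (\sum_m f (l m)) * (\prod_i w (l i)) * \det (evalmx A N L phi l).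
(* One of the two determinants is expanded over permutations. Relabelling [l] by [s] gives the other
   one the sign of [s], which cancels, so all permutations contribute equally. *)
transitivity (\sum_(s : 'S_N) \sum_l t l * \prod_i phi i (l i)).
  transitivity (\sum_(s : 'S_N) \sum_l t l * ((-1) ^+ s * \prod_i phi (s i) (l i))).
    rewrite exchange_big; apply: eq_bigr => l _ /=.
    rewrite expr2 mulrA -mulr_sumr; congr (_ * _).
    rewrite /determinant; apply: eq_bigr => s _; congr (_ * _).
    by apply: eq_bigr => i _; rewrite mxE.
  apply: eq_bigr => s _; rewrite (reindex_inj (permute_inj N L s)).
  apply: eq_bigr => l _; rewrite /t det_evalmx_permute.
  have -> : \prod_i phi (s i) (permute N L s l i) = \prod_i phi i (l i).
    by rewrite [RHS](reindex_inj (@perm_inj _ s)); apply: eq_bigr => i _; rewrite ffunE.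
  have -> : \prod_i w (permute N L s l i) = \prod_i w (l i).
    by rewrite [RHS](reindex_inj (@perm_inj _ s)); apply: eq_bigr => i _; rewrite ffunE.
  have -> : \sum_i f (permute N L s l i) = \sum_i f (l i).
    by rewrite [RHS](reindex_inj (@perm_inj _ s)); apply: eq_bigr => i _; rewrite ffunE.
  have sE (x y z e : A) : x * (e * y) * (e * z) = e * (e * (x * y * z)) by ring.
  by rewrite sE signrMK.
rewrite sumr_const card_Sn -[LHS]mulr_natl; congr (_ * _).
under [RHS]eq_bigr => m _.
  rewrite /determinant.
  under eq_bigr => s _.
    under eq_bigr => i _ do rewrite mxE.
    rewrite bigA_distr_bigA /= mulr_sumr.
    over.
  rewrite exchange_big /=.
  over.
rewrite exchange_big /=; apply: eq_bigr => l _.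
rewrite /t mulr_suml mulr_suml mulr_suml; apply: eq_bigr => m _.
rewrite mulrAC /determinant mulr_sumr; apply: eq_bigr => s _.
rewrite mulrCA; congr (_ * _); rewrite !big_split /=.
(* The factor is spread over the rows, as [f] in row [m] and 1 elsewhere, to match the entries of
   the matrix of index [m]. *)
have -> : f (l m) = \prod_i (if i == m then f (l i) else 1).
  by rewrite -big_mkcond big_pred1_eq.
by congr (_ * _); apply: eq_bigr => i _; rewrite mxE.
Qed.

(** * The truncated sums and their limit *)

Lemma cvg_det (R : realType) (n : nat) (M : nat -> 'M[R]_n) (M' : 'M[R]_n) :
  (forall i j, (fun L => M L i j) @ \oo --> M' i j) ->
  (fun L => \det (M L)) @ \oo --> \det M'.
Proof.
move=> cM; apply: (cvg_big add_continuous) => s _; apply: cvgM; first exact: cvg_cst.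
by apply: (cvg_big mul_continuous) => i _; apply: cM.
Qed.

(** A permutation that fixes every index but [m] fixes [m] too, so any other than the identity moves
    some row that is diagonal. *)
Lemma det_diag_but_row (A : comNzRingType) (n : nat) (m : 'I_n) (M : 'M[A]_n) :
  (forall i j, i != m -> j != i -> M i j = 0) -> \det M = \prod_i M i i.
Proof.
move=> M0; rewrite /determinant (bigD1 (1%g : 'S_n)) //= odd_perm1 mul1r.
rewrite [X in _ + X]big1 ?addr0; first by apply: eq_bigr => i _; rewrite perm1.
move=> s s1; have [i im si] : exists2 i, i != m & s i != i.
  apply/exists_inP; apply: contraNT s1 => /exists_inPn nex; apply/eqP/permP => i.
  have fixs j : j != m -> s j = j.
    by move=> /nex; rewrite negbK => /eqP.
  rewrite perm1; have [->|/fixs//] := eqVneq i m.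
  apply/eqP; apply: contraT => sm; have /perm_inj/eqP := fixs _ sm.
  by rewrite (negbTE sm).
by rewrite (bigD1 i) //= M0 // mul0r mulr0.
Qed.

(** Up to the constant N q^(N(N-1)/2), the terms of the partitions with at most [N] parts whose
    shifted parts are below [L]. *)
Definition trunc_sum (R : realType) (q : R) (N k L : nat) : R :=
  \sum_(l : {ffun 'I_N -> 'I_L} | strictly_decr N L l)
    (\sum_m ((l m) ^_ k)%:R) * (\prod_i q ^+ l i) *
    \det (binmx R N (padded L N l)) ^+ 2.

Lemma trunc_sumE (R : realType) (q : R) (N k L : nat) :
  trunc_sum R q N k L = \sum_m \det (\matrix_(i < N, j < N)
    if i == m then k`!%:R * moment R q k (N - i.+1).+1 (N - j.+1).+1 L
    else moment R q 0 (N - i.+1).+1 (N - j.+1).+1 L).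
Proof.
have N0 : N`!%:R != 0 :> R by rewrite pnatr_eq0 -lt0n fact_gt0.
apply: (mulfI N0).
pose e := - (q / (1 - q)).
pose phi (j : 'I_N) (x : 'I_L) := meixner R e (N - j.+1) x.
have detE (l : {ffun 'I_N -> 'I_L}) :
    \det (binmx R N (padded L N l)) = \det (evalmx R N L phi l).
  rewrite -(det_meixner _ e); congr (\det _).
  by apply/matrixP => i j; rewrite !mxE paddedE.
transitivity (N`!%:R * \sum_m \det (\matrix_(i < N, j < N)
  \sum_(x < L) (if i == m then (x ^_ k)%:R else 1) * q ^+ x * phi i x * phi j x)); last first.
  congr (_ * _); apply: eq_bigr => m _; congr (\det _); apply/matrixP => i j.
  rewrite !mxE; case: ifP => _.
    rewrite /moment mulr_sumr; apply: eq_bigr => x _.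
    by rewrite /= -/e -bin_ffact natrM /phi; ring.
  by apply: eq_bigr => x _; rewrite /= -/e bin0 /phi; ring.
rewrite -(sum_det_sqr R N L (fun x : 'I_L => (x ^_ k)%:R) (fun x : 'I_L => q ^+ x)).
rewrite /trunc_sum.
under eq_bigr => l _ do rewrite detE.
rewrite -(sum_symmetric R N L (fun l : {ffun 'I_N -> 'I_L} => (\sum_m ((l m) ^_ k)%:R) *
  (\prod_i q ^+ l i) * \det (evalmx R N L phi l) ^+ 2)) // => [s l|l l_ninj].
  rewrite det_evalmx_permute exprMn sqrr_sign mul1r; congr (_ * _ * _).
    by rewrite [RHS](reindex_inj (@perm_inj _ s)); apply: eq_bigr => i _; rewrite ffunE.
  by rewrite [RHS](reindex_inj (@perm_inj _ s)); apply: eq_bigr => i _; rewrite ffunE.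
by rewrite det_evalmx_noninj // expr0n mulr0.
Qed.

(** Orthogonality of the Meixner polynomials: for k = 0 the recurrence ties (n, m) to (n-1, m-1)
    only, and its source sits at n = m = 0. *)
Lemma mlim0_diag (A : comNzRingType) (q y : A) (n m : nat) :
  mlim A q y 0 n.+1 m.+1 = if n == m then (q * y ^+ 2) ^+ n else 0.
Proof.
elim: n m => [|n IHn] [|m]; rewrite mlim_rec0.
- by rewrite /mlim big_ord0 mulr0 add0r expr0.
- by rewrite /mlim big_ord0 mulr0 add0r.
- by rewrite /mlim big1 ?mulr0 ?add0r // => i _; rewrite /(mcoef _ _ _ 0) mulr0 !mul0r.
- by rewrite IHn !eqSS addr0; case: ifP => _; rewrite ?mulr0 // -exprS.
Qed.

(** On the diagonal the power of [y] is the same for every [p]; factoring out [q ^+ n] leaves the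
    powers of 1/q of the hypergeometric series. *)
Lemma mlim_diag (A : comNzRingType) (q qv y : A) (k n : nat) : q * qv = 1 ->
  mlim A q y k n.+1 n.+1 = (q * y ^+ 2) ^+ n *
    \sum_(p < n.+1) ('C(k, n - p) ^ 2 * 'C(p + k, k))%:R * qv ^+ (n - p).
Proof.
move=> qqv; rewrite /mlim mulr_sumr; apply: eq_bigr => p _.
have e : (q * y ^+ 2) ^+ n = (q * y ^+ 2) ^+ p * (q * y ^+ 2) ^+ (n - p).
  by rewrite -exprD subnKC // -ltnS.
rewrite /mcoef ltn_ord /= e; move: (n - p)%N => i.
have qi : q ^+ i * qv ^+ i = 1 by rewrite -exprMn qqv expr1n.
have -> : (q * y ^+ 2) ^+ i = q ^+ i * (y ^+ i * y ^+ i) by rewrite exprMn expr2 exprMn.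
by rewrite !natrM -[LHS]mulr1 -qi; move: ((q * _) ^+ p) => z; ring.
Qed.

(** The limit matrices are diagonal outside row [m], so each determinant is a product of squared
    norms with the one of row [m] replaced by a moment of order [k]. Factoring out all the norms
    leaves the trace. *)
Lemma trunc_sum_cvg (R : realType) (q : R) (N k : nat) : 0 < q -> q < 1 ->
  trunc_sum R q N k @ \oo -->
  k`!%:R * q ^+ k * (1 - q)^-1 ^+ k *
  (\prod_(i < N) ((1 - q)^-1 * (q * (1 - q)^-1 ^+ 2) ^+ (N - i.+1))) *
  \sum_(n < N) \sum_(p < n.+1)
     ('C(k, n - p) ^ 2 * 'C(p + k, k))%:R * q^-1 ^+ (n - p).
Proof.
move=> q0 q1; rewrite (funext (trunc_sumE R q N k)).
set y := (1 - q)^-1.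
have y0 : y != 0 by rewrite invr_eq0 subr_eq0 gt_eqF.
pose M' m : 'M[R]_N := \matrix_(i, j)
  if i == m then k`!%:R * (q ^+ k * y ^+ k.+1 * mlim R q y k (N - i.+1).+1 (N - j.+1).+1)
  else q ^+ 0 * y ^+ 1 * mlim R q y 0 (N - i.+1).+1 (N - j.+1).+1.
set lim := (X in _ --> X).
have -> : lim = \sum_m \det (M' m).
  rewrite /lim [X in _ * X = _](reindex_inj rev_ord_inj) /= mulr_sumr; apply: eq_bigr => m _.
  rewrite (det_diag_but_row _ _ m); last first.
    move=> i j im ji; rewrite mxE (negbTE im) mlim0_diag ifF ?mulr0 //.
    apply: contraNF ji => /eqP e; apply/eqP/val_inj => /=.
    by have := ltn_ord i; have := ltn_ord j; lia.
  rewrite [RHS](bigD1 m) //= [X in _ * X * _](bigD1 m) //= mxE eqxx.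
  rewrite (mlim_diag _ _ q^-1) ?mulfV ?gt_eqF //.
  rewrite [X in _ = _ * X](eq_bigr (fun i : 'I_N => y * (q * y ^+ 2) ^+ (N - i.+1))); last first.
    by move=> i im; rewrite mxE (negbTE im) mlim0_diag eqxx expr0 mul1r expr1.
  by rewrite [y ^+ k.+1]exprS; ring.
apply: (cvg_big add_continuous) => m _; apply: cvg_det => i j.
under eq_fun do rewrite mxE.
rewrite mxE; case: ifP => _; last exact: moment_cvg.
by apply: cvgM; [exact: cvg_cst | exact: moment_cvg].
Qed.

(** * Summation over partitions *)

(** Every finite subset of [D] is eventually contained in [s n], which bounds the sum from above;
    each [s n] is itself a finite subset of [D], which bounds it from below. *)
Lemma esum_exhaustion (R : realType) (T : choiceType) (D : set T) (g : T -> R)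
    (s : nat -> seq T) (a : R) :
    (forall x, D x -> 0 <= g x) -> (forall n, uniq (s n)) ->
    (forall n x, x \in s n -> D x) ->
    (forall x, D x -> \forall n \near \oo, x \in s n) ->
    (fun n => \sum_(x <- s n) g x) @ \oo --> a ->
  \esum_(x in D) (g x)%:E = a%:E.
Proof.
move=> g0 s_uniq sD Ds cvg_a.
have sumE n : (\sum_(x \in [set` s n]) (g x)%:E = (\sum_(x <- s n) g x)%:E)%E.
  by rewrite -fsbig_seq // sumEFin.
have cvgE : (fun n => (\sum_(x <- s n) g x)%:E) @ \oo --> a%:E.
  by apply: cvg_EFin => //; near=> n.
have limE := cvg_lim (@ereal_hausdorff R) cvgE.
apply/eqP; rewrite eq_le; apply/andP; split.
  apply: ge_ereal_sup => _ [A [/finite_seqP[r ->] rD] <-].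
  rewrite -limE; apply: lime_ge; first by apply/cvg_ex; exists a%:E.
  have : \forall n \near \oo, {subset r <= s n}.
    elim: r rD => [|x r IHr] rD; first by near=> n => y; rewrite in_nil.
    have r_s : \forall n \near \oo, {subset r <= s n}.
      by apply: IHr => y /= yr; apply: rD; rewrite /= inE yr orbT.
    have x_s : \forall n \near \oo, x \in s n by apply: Ds; apply: rD; rewrite /= mem_head.
    near=> n => y; rewrite inE => /predU1P[->|]; first by near: n.
    by move: y; near: n.
  apply: filterS => n r_s; rewrite -sumE.
  apply: lee_fsum_nneg_subset; [exact: finite_seq|exact: finite_seq| |].
    by move=> x; rewrite !inE => /r_s.
  by move=> x; rewrite !inE => /andP[_]; rewrite inE /= => xs; rewrite lee_fin; apply/g0/(sD n).
rewrite -limE; apply: lime_le; first by apply/cvg_ex; exists a%:E.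
near=> n; rewrite -sumE; apply: esum_ge; exists [set` s n] => //.
by split; [exact: finite_seq | move=> x /=; exact: sD].
Unshelve. all: by end_near. Qed.

Lemma partition_eq (la mu : seq nat) : is_partition la -> is_partition mu ->
  nth 0%N la =1 nth 0%N mu -> la = mu.
Proof.
move=> la_p mu_p e.
have size_le s t : is_partition s -> is_partition t -> nth 0%N s =1 nth 0%N t ->
    (size t <= size s)%N.
  move=> s_p t_p st; rewrite leqNgt; apply/negP => lt_st.
  have := partition_nth_gt0 t (size s) t_p; rewrite lt_st -st.
  by rewrite partition_nth_gt0 // ltnn.
have sz : size la = size mu by apply/anti_leq; rewrite !size_le.
exact: (eq_from_nth (x0 := 0%N)).
Qed.

(** The zeros of a decreasing sequence come last, so dropping them moves no other part, and the
    default value 0 stands in for them. *)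
Lemma nth_filter_pos (s : seq nat) (i : nat) :
  sorted geq s -> nth 0%N [seq x <- s | (0 < x)%N] i = nth 0%N s i.
Proof.
elim: s i => [//|x s IHs] i /= xs.
have s_sorted := path_sorted xs.
case: ltnP => [x0|]; first by case: i => //= i; apply: IHs.
rewrite leqn0 => /eqP x0; rewrite IHs //.
have s0 j : nth 0%N s j = 0%N.
  have [j_s|/(nth_default 0%N)//] := ltnP j (size s).
  have /allP/(_ _ (mem_nth 0%N j_s)) : all (geq x) s.
    by apply: order_path_min xs => ? ? ? h1 h2; apply: leq_trans h2 h1.
  by rewrite x0 /= leqn0 => /eqP.
by case: i => [|i] /=; rewrite !s0.
Qed.

(** The inverse of l_i = la_i + N-1-i; filtering drops the trailing zeros, which [is_partition]
    forbids. *)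
Definition partition_of (N L : nat) (l : {ffun 'I_N -> 'I_L}) : seq nat :=
  [seq x <- mkseq (fun i => padded L N l i - (N - i.+1))%N N | (0 < x)%N].

(** At d = N-1-i, this makes the truncated subtractions in [partition_of] exact. *)
Lemma strictly_decr_stair (N L : nat) (l : {ffun 'I_N -> 'I_L}) :
    strictly_decr N L l ->
  forall d i, (i + d < N)%N -> (d <= padded L N l i)%N.
Proof.
move=> /strictly_decrP dl; elim=> [//|d IHd] i lt_N.
have i_N : (i < N)%N by lia.
have i1_N : (i.+1 < N)%N by lia.
have := dl (Ordinal i_N) (Ordinal i1_N) (ltnSn i).
rewrite -!padded_lt; have := IHd i.+1; lia.
Qed.

Lemma sorted_stair (N L : nat) (l : {ffun 'I_N -> 'I_L}) :
    strictly_decr N L l ->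
  sorted geq (mkseq (fun i => padded L N l i - (N - i.+1))%N N).
Proof.
move=> dl; apply/(sortedP 0%N) => i; rewrite size_mkseq => i1_N.
have i_N : (i < N)%N by lia.
rewrite !nth_mkseq //=; move/strictly_decrP: dl => dl.
have := dl (Ordinal i_N) (Ordinal i1_N) (ltnSn i).
by rewrite -!padded_lt; lia.
Qed.

Lemma partition_of_partition (N L : nat) (l : {ffun 'I_N -> 'I_L}) :
  strictly_decr N L l -> is_partition (partition_of N L l).
Proof.
move=> dl; apply/andP; split; last by rewrite mem_filter.
apply: sorted_filter; last exact: sorted_stair.
by move=> ? ? ? h1 h2; apply: leq_trans h2 h1.
Qed.

Lemma size_partition_of (N L : nat) (l : {ffun 'I_N -> 'I_L}) :
  (size (partition_of N L l) <= N)%N.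
Proof. by rewrite size_filter (leq_trans (count_size _ _)) // size_mkseq. Qed.

Lemma shifted_partition_of (N L : nat) (l : {ffun 'I_N -> 'I_L}) (i : 'I_N) :
  strictly_decr N L l -> shifted N (nth 0%N (partition_of N L l)) i = l i.
Proof.
move=> dl; rewrite /shifted nth_filter_pos; last exact: sorted_stair.
have := ltn_ord i => i_N; rewrite nth_mkseq // subnK ?paddedE // -paddedE.
by apply: strictly_decr_stair => //; lia.
Qed.

Lemma partition_of_inj (N L : nat) :
  {in strictly_decr N L &, injective (partition_of N L)}.
Proof.
move=> l l' dl dl' e; apply/ffunP => i; apply: val_inj => /=.
by rewrite -(shifted_partition_of N L l i dl) e shifted_partition_of.
Qed.

Lemma partition_of_surj (N L : nat) (la : seq nat) :
    is_partition la -> (size la <= N)%N -> (nth 0%N la 0 + N <= L)%N ->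
  exists2 l : {ffun 'I_N -> 'I_L}, strictly_decr N L l & partition_of N L l = la.
Proof.
move=> la_p la_N la_L; have laD := partition_nth_homo la la_p.
have sh_L (i : 'I_N) : (shifted N (nth 0%N la) i < L)%N.
  by have := laD _ _ (leq0n i); have := ltn_ord i; rewrite /shifted; lia.
pose l : {ffun 'I_N -> 'I_L} := [ffun i => Ordinal (sh_L i)].
have dl : strictly_decr N L l.
  apply/strictly_decrP => i j lt_ij; rewrite !ffunE /= /shifted.
  by have := laD _ _ (ltnW lt_ij); have := ltn_ord j; lia.
exists l => //; apply: partition_eq => // [|i]; first exact: partition_of_partition.
have [i_N|N_i] := ltnP i N; last first.
  by rewrite !nth_default // (leq_trans _ N_i) // size_partition_of.
have := shifted_partition_of N L l (Ordinal i_N) dl.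
by rewrite ffunE /= /shifted => /addIn.
Qed.

Lemma sumn_shifted (N : nat) (la : seq nat) : (size la <= N)%N ->
  (sumn la + \sum_(i < N) (N - i.+1) = \sum_(i < N) shifted N (nth 0 la) i)%N.
Proof.
move=> la_N; rewrite big_split /=; congr (_ + _)%N.
rewrite sumnE (big_nth 0%N) big_mkord (big_ord_widen N (nth 0%N la)) //.
rewrite big_mkcond; apply: eq_bigr => i _ /=.
by case: ltnP => // /(nth_default 0%N).
Qed.

Lemma summand_partition_of (R : realType) (q : R) (N k L : nat)
    (l : {ffun 'I_N -> 'I_L}) : q != 0 -> strictly_decr N L l ->
  Fmean R N k (partition_of N L l) * q ^+ sumn (partition_of N L l)
    * schur (partition_of N L l) (fun _ : 'I_N => 1 : R)
    * schur (partition_of N L l) (fun _ : 'I_N => 1 : R) =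
  (N%:R * q ^+ (\sum_(i < N) (N - i.+1)))^-1 *
  ((\sum_m ((l m) ^_ k)%:R) * (\prod_i q ^+ l i) *
    \det (binmx R N (padded L N l)) ^+ 2).
Proof.
move=> q0 dl; have la_p := partition_of_partition N L l dl.
have la_N := size_partition_of N L l; set la := partition_of N L l in la_p la_N *.
have lE (i : 'I_N) : shifted N (nth 0%N la) i = l i by apply: shifted_partition_of.
rewrite !schur1_det //.
have -> : binmx R N (shifted N (nth 0%N la)) = binmx R N (padded L N l).
  by apply/matrixP => i j; rewrite !mxE lE paddedE.
have -> : \prod_i q ^+ l i = q ^+ sumn la * q ^+ (\sum_(i < N) (N - i.+1)).
  rewrite -exprD sumn_shifted // expr_sum.
  by apply: eq_bigr => i _; rewrite lE.
rewrite /Fmean invfM expr2.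
have -> : \sum_(i < N) ((nth 0%N la i + (N - i.+1)) ^_ k)%:R =
    \sum_m ((l m) ^_ k)%:R :> R by apply: eq_bigr => i _; rewrite -lE.
have : q ^+ (\sum_(i < N) (N - i.+1)) != 0 by rewrite expf_neq0.
set x := q ^+ \sum_(_ < _) _ => x0.
have xE (c u v d : R) : c * u * v * d * d = c * x^-1 * (u * (v * x) * (d * d)) by field.
exact: xE.
Qed.

Lemma esum_trunc (R : realType) (q a : R) (N k : nat) :
    0 < q -> trunc_sum R q N k @ \oo --> a ->
  \esum_(la in [set la : seq nat | is_partition la])
    (Fmean R N k la * q ^+ sumn la
       * schur la (fun _ : 'I_N => 1 : R) * schur la (fun _ : 'I_N => 1 : R))%:E
  = ((N%:R * q ^+ (\sum_(i < N) (N - i.+1)))^-1 * a)%:E.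
Proof.
move=> q0 cvg_a; pose g (la : seq nat) : R := Fmean R N k la * q ^+ sumn la
  * schur la (fun _ : 'I_N => 1 : R) * schur la (fun _ : 'I_N => 1 : R).
transitivity (\esum_(la in [set la | is_partition la] `&`
    [set la | (size la <= N)%N]) (g la)%:E).
  rewrite esum_mkcondr; apply: eq_esum => la /= la_p.
  case: ifPn => //; rewrite notin_setE /= => /negP; rewrite -ltnNge => N_la.
  by rewrite schur1_gt_size // mulr0.
apply: (esum_exhaustion R _ _ g
    (fun L => [seq partition_of N L l | l <- enum (strictly_decr N L)])).
- move=> la _; rewrite /g -mulrA -expr2 mulr_ge0 ?sqr_ge0 // mulr_ge0 ?exprn_ge0 ?(ltW q0) //.
  by rewrite /Fmean mulr_ge0 ?invr_ge0 ?ler0n // sumr_ge0 // => i _; rewrite ler0n.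
- move=> L; rewrite map_inj_in_uniq ?enum_uniq // => l l'.
  by rewrite !mem_enum; apply: partition_of_inj.
- move=> L la /mapP[l]; rewrite mem_enum => dl ->; split=> /=.
    exact: partition_of_partition.
  exact: size_partition_of.
- move=> la /= [la_p la_N]; exists (nth 0%N la 0 + N)%N => // L /= la_L.
  have [l dl <-] := partition_of_surj N L la la_p la_N la_L.
  by apply: map_f; rewrite mem_enum.
rewrite (_ : (fun L => _) = (fun L =>
    (N%:R * q ^+ (\sum_(i < N) (N - i.+1)))^-1 * trunc_sum R q N k L)).
  by apply: cvgM => //; exact: cvg_cst.
apply/funext => L; rewrite big_map big_enum /trunc_sum mulr_sumr /=.
by apply: eq_bigr => l dl; apply: summand_partition_of => //; rewrite gt_eqF.
Qed.

(** * The hypergeometric side *)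

Lemma hockey_stick (k M : nat) : (\sum_(p < M) 'C(p + k, k) = 'C(M + k, k.+1))%N.
Proof.
elim: M => [|M IHM]; first by rewrite big_ord0 bin_small.
by rewrite big_ord_recr /= IHM addSn binS.
Qed.

Lemma sum_diagonal (A : nmodType) (N : nat) (g : nat -> nat -> A) :
  \sum_(n < N) \sum_(p < n.+1) g (n - p)%N p = \sum_(i < N) \sum_(p < N - i) g i p.
Proof.
elim: N => [|N IHN]; first by rewrite !big_ord0.
rewrite big_ord_recr /= IHN.
transitivity (\sum_(i < N.+1) ((\sum_(p < N - i) g i p) + g i (N - i)%N)).
  rewrite big_split /=; congr (_ + _).
    by rewrite big_ord_recr /= subnn big_ord0 addr0.
  rewrite (reindex_inj rev_ord_inj); apply: eq_bigr => i _ /=.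
  by rewrite subSS subKn // -ltnS.
by apply: eq_bigr => i _; rewrite subSn ?big_ord_recr // -ltnS.
Qed.

Lemma pochhammerS (R : realType) (a : R) (i : nat) :
  pochhammer a i.+1 = pochhammer a i * (a + i%:R).
Proof. by rewrite /pochhammer big_ord_recr. Qed.

Lemma pochhammerN (R : realType) (n i : nat) :
  pochhammer (- n%:R : R) i = (-1) ^+ i * (n ^_ i)%:R.
Proof.
elim: i => [|i IHi]; first by rewrite /pochhammer big_ord0 expr0 mul1r ffactn0.
rewrite pochhammerS IHi ffactnSr natrM.
have [le_in|lt_ni] := leqP i n; last by rewrite ffact_small // !(mulr0, mul0r).
by rewrite natrB // exprS; ring.
Qed.

Lemma pochhammer1 (R : realType) (i : nat) : pochhammer (1 : R) i = i`!%:R.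
Proof.
elim: i => [|i IHi]; first by rewrite /pochhammer big_ord0.
by rewrite pochhammerS IHi factS natrM mulrC -natr1 addrC.
Qed.

Lemma pochhammerSn (R : realType) (N k : nat) :
  pochhammer (N%:R + 1 : R) k = ((N + k) ^_ k)%:R.
Proof.
elim: k => [|k IHk]; first by rewrite /pochhammer big_ord0 ffactn0.
by rewrite pochhammerS IHk addnS ffactnS /= natrM mulrC -natr1 natrD; congr (_ * _); ring.
Qed.

(** The factor (1-N)_i vanishes for i >= N, so the partial sums are constant from [N] on. Below [N],
    the three signs of the numerator cancel against that of the denominator, and the falling
    factorials of [k] over the two i! give the squared binomial. *)
Lemma hyp3F2_sum (R : realType) (N k : nat) (z : R) : (0 < N)%N ->
  hyp3F2 (- k%:R) (- k%:R) (1 - N%:R) 1 (- N%:R - k%:R) z =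
  \sum_(i < N) ('C(k, i) ^ 2)%:R * (N.-1 ^_ i)%:R / ((N + k) ^_ i)%:R * z ^+ i.
Proof.
move=> N0; rewrite /hyp3F2.
have -> : 1 - N%:R = - (N.-1)%:R :> R.
  by rewrite -[N in LHS]prednK // -natr1; ring.
have -> : - N%:R - k%:R = - (N + k)%:R :> R by rewrite natrD opprD.
set u := (fun i : nat => _); apply: cvg_lim => //.
apply: cvg_near_cst; exists N => // M /= le_NM.
rewrite /series /= (big_cat_nat (leq0n N) le_NM) /=.
rewrite [X in _ + X]big_nat_cond [X in _ + X]big1 ?addr0; last first.
  move=> i /andP[/andP[le_Ni _] _]; rewrite /u (pochhammerN R N.-1) ffact_small; last by lia.
  by rewrite !(mulr0, mul0r).
rewrite big_mkord; apply: eq_bigr => i _; rewrite /u !pochhammerN pochhammer1.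
have fi : i`!%:R != 0 :> R by rewrite pnatr_eq0 -lt0n fact_gt0.
have gi : ((N + k) ^_ i)%:R != 0 :> R.
  by rewrite pnatr_eq0 -lt0n ffact_gt0; have := ltn_ord i; lia.
have si : (-1) ^+ i != 0 :> R by rewrite signr_eq0.
rewrite -(bin_ffact k) expnS expn1 !natrM.
move: si (sqrr_sign R i); move: ((-1) ^+ i) => s si ss.
rewrite -[RHS]mul1r -ss expr2; field.
by rewrite fi gi si.
Qed.

(** Once multiplied by (N-1-i)!, both sides equal (N+k)!. This compares the coefficients of q^(-i)
    on the two sides of the final identity. *)
Lemma coefficient_identity (N k i : nat) : (i < N)%N ->
  (N * (N + k) ^_ k * N.-1 ^_ i = k.+1`! * 'C(N - i + k, k.+1) * (N + k) ^_ i)%N.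
Proof.
move=> i_N; apply/eqP; rewrite -(eqn_pmul2r (fact_gt0 (N.-1 - i))); apply/eqP.
have N_E : (N`! = N * N.-1`!)%N by case: N i_N => // N; rewrite factS.
have e1 : (N.-1 ^_ i * (N.-1 - i)`! = N.-1`!)%N by apply: ffact_fact; lia.
have e2 : ((N + k) ^_ k * N`! = (N + k)`!)%N.
  by rewrite -[X in X`!](addnK k N) ffact_fact // leq_addl.
have e3 : ((N + k) ^_ i * (N - i + k)`! = (N + k)`!)%N.
  by rewrite -[RHS](@ffact_fact _ i); [congr (_ * _`!)%N | ]; lia.
have e4 : ('C(N - i + k, k.+1) * (k.+1`! * (N.-1 - i)`!) = (N - i + k)`!)%N.
  by rewrite -[RHS](@bin_fact _ k.+1); [congr (_ * (_ * _`!))%N | ]; lia.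
transitivity (N + k)`!.
  by rewrite -e2 N_E -e1; ring.
by rewrite -e3 -e4; ring.
Qed.

Lemma trunc_sum_limit_value (R : realType) (q : R) (N k : nat) :
    0 < q -> q < 1 -> (0 < N)%N ->
  (N%:R * q ^+ (\sum_(i < N) (N - i.+1)))^-1 *
  (k`!%:R * q ^+ k * (1 - q)^-1 ^+ k *
  (\prod_(i < N) ((1 - q)^-1 * (q * (1 - q)^-1 ^+ 2) ^+ (N - i.+1))) *
  \sum_(n < N) \sum_(p < n.+1)
     ('C(k, n - p) ^ 2 * 'C(p + k, k))%:R * q^-1 ^+ (n - p)) =
  q ^+ k * pochhammer (N%:R + 1) k / ((1 - q) ^+ (N ^ 2 + k) * (k%:R + 1)) *
  hyp3F2 (- k%:R) (- k%:R) (1 - N%:R) 1 (- N%:R - k%:R) (1 / q).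
Proof.
move=> q0 q1 N0; set E := (\sum_(i < N) (N - i.+1))%N; set y := (1 - q)^-1.
(* The product of the norms carries [y] to the power N + 2E, and E = N(N-1)/2. *)
have E2 : (N + 2 * E = N ^ 2)%N.
  have -> : E = 'C(N, 2).
    rewrite -bin2_sum big_mkord /E (reindex_inj rev_ord_inj) /=.
    by apply: eq_bigr => i _; have := ltn_ord i; lia.
  elim: (N) => // n IHn; rewrite binS bin1 -[n.+1 in RHS]addn1 sqrnD -IHn.
  by rewrite exp1n muln1; lia.
have -> : \prod_(i < N) (y * (q * y ^+ 2) ^+ (N - i.+1)) = q ^+ E * y ^+ (N ^ 2).
  rewrite big_split /= prodr_const card_ord -expr_sum -/E exprMn -exprM -E2 exprD.
  by ring.
(* Grouping by i = n - p, the index of the hypergeometric sum, leaves a sum over p < N - i for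
   [hockey_stick]. *)
rewrite (sum_diagonal _ N (fun i p => ('C(k, i) ^ 2 * 'C(p + k, k))%:R * q^-1 ^+ i)).
rewrite hyp3F2_sum // pochhammerSn.
have q0' : q ^+ E != 0 by rewrite expf_neq0 // gt_eqF.
have N0' : N%:R != 0 :> R by rewrite pnatr_eq0 -lt0n.
have k0 : k%:R + 1 != 0 :> R by rewrite natr1 pnatr_eq0.
rewrite !mulr_sumr; apply: eq_bigr => i _.
transitivity ((N%:R)^-1 * (k`!%:R * q ^+ k * y ^+ (N ^ 2 + k)) *
   (('C(k, i) ^ 2)%:R * ('C(N - i + k, k.+1))%:R * q^-1 ^+ i)).
  rewrite -hockey_stick natr_sum !mulr_sumr mulr_suml !mulr_sumr.
  apply: eq_bigr => p _; rewrite natrM exprD; move: (q^-1 ^+ i) => z; field.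
  by rewrite q0' N0'.
have y0 : y ^+ (N ^ 2 + k) != 0 by rewrite expf_neq0 // invr_eq0 subr_eq0 gt_eqF.
have -> : (1 - q) ^+ (N ^ 2 + k) = (y ^+ (N ^ 2 + k))^-1.
  by rewrite -exprVn invrK.
have := congr1 (fun n => n%:R : R) (coefficient_identity N k i (ltn_ord i)).
rewrite /= factS !natrM -natr1.
have gi : ((N + k) ^_ i)%:R != 0 :> R.
  by rewrite pnatr_eq0 -lt0n ffact_gt0; have := ltn_ord i; lia.
rewrite div1r; move: (y ^+ (N ^ 2 + k)) y0 (q^-1 ^+ i) => Y y0 Q.
move: (('C(k, i))%:R : R) => C h.
apply/eqP; rewrite -subr_eq0; set lhs := (X in X == 0).
(* The difference of the two sides of the goal is this factor times that of [h]. *)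
have -> : lhs = - (q ^+ k * Y * (C * C) * Q / (N%:R * (k%:R + 1) * ((N + k) ^_ i)%:R)) * 0.
  rewrite -(subrr ((k%:R + 1) * k`!%:R * ('C(N - i + k, k.+1))%:R * ((N + k) ^_ i)%:R)).
  by rewrite -{1}h /lhs; field; rewrite N0' k0 gi y0.
by rewrite mulr0.
Qed.

Theorem corollary2 (R : realType) (q : R) (N k : nat)
    (hq0 : 0 < q) (hq1 : q < 1) (hN : (1 <= N)%N) :
  \esum_(la in [set la : seq nat | is_partition la])
    (Fmean R N k la * q ^+ sumn la
       * schur la (fun _ : 'I_N => 1 : R) * schur la (fun _ : 'I_N => 1 : R))%:E
  = (q ^+ k * pochhammer (N%:R + 1) k
       / ((1 - q) ^+ (N ^ 2 + k) * (k%:R + 1))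
       * hyp3F2 (- k%:R) (- k%:R) (1 - N%:R) 1 (- N%:R - k%:R) (1 / q))%:E.
Proof.
rewrite (esum_trunc _ _ _ _ _ hq0 (trunc_sum_cvg _ _ _ _ hq0 hq1)).
by rewrite trunc_sum_limit_value.
Qed.
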